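(* Let $m,p,n$ be positive integers with $p\mid m$ and let $G=G(m,p,n)$. Then $g\in G$ has a shortest reflection factorization $f$ such that $G_f=G$ if and only if the following conditions hold: (i) the cycle weights of $g$ generate $\mathbb Z/m\mathbb Z$; (ii) the weight of $g$ generates $p\mathbb Z/m\mathbb Z$; and (iii) no nontrivial subset of the cycles of $g$ has weight $0$ modulo $p$. (If $p=m$, then condition (ii) is vacuous.)
   Context: Let $\omega=\exp(2\pi i/m)$. $G(m,p,n)$ is the group of $n\times n$ complex monomial matrices (exactly one nonzero entry in each row and column) whose nonzero entries are $m$th roots of unity with product an $(m/p)$th root of unity. An element is written $g=[u;(a_1,\ldots,a_n)]$ with $u=\pi(g)\in\mathfrak S_n$ (the underlying permutation) and $a_j\in\mathbb Z/m\mathbb Z$, meaning that the nonzero entry of column $j$ is $\omega^{a_j}$, in row $u(j)$. The weight of $g$ is $a_1+\cdots+a_n\in\mathbb Z/m\mathbb Z$. A cycle of $g$ is a cycle of $\pi(g)$ (fixed points count as cycles); its weight is the sum of the $a_j$ over the elements $j$ of the cycle, and the weight of a set of cycles is the sum of their weights. A nontrivial subset of the set of cycles is a nonempty proper subset. A reflection of $G$ is an element whose fixed space in $\mathbb C^n$ is a hyperplane. A reflection factorization of $g$ is a tuple $f=(t_1,\ldots,t_\ell)$ of reflections in $G$ with $t_1\cdots t_\ell=g$; it is shortest if $\ell$ is minimum possible. $G_f$ is the subgroup of $G$ generated by the factors of $f$.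
   Formalization: The case n = 1 < p is excluded: there a generator g of the cyclic group G(m,p,1) has a shortest reflection factorization generating G, but its only cycle weight is a multiple of p > 1, so (i) fails. The remark on p = m is not stated separately. *)

(* Defs.v *)
From HB Require Import structures.
From mathcomp Require Import all_boot all_order all_algebra all_fingroup.
From mathcomp Require Import complex ring lra.
From mathcomp Require Import boolp classical_sets reals trigo.

Set Implicit Arguments.
Unset Strict Implicit.
Unset Printing Implicit Defensive.

Import Order.TTheory GRing.Theory Num.Theory.

Local Open Scope classical_set_scope.
Local Open Scope ring_scope.
Local Open Scope complex_scope.

(* The additive group Z/m for m > 0. It is 'I_m.-1.+1 rather than 'Z_m because
   'Z_1 is Z/2, whereas m = 1 has to be allowed. *)
Notation Zmod m := ('I_m.-1.+1).

Section Monomial.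
Variables (R : realType) (m p n : nat).
Implicit Types (g t : 'M[R[i]]_n) (f : seq 'M[R[i]]_n).

(* exp (2 i pi / m) *)
Definition omega : R[i] :=
  cos (2%:R * pi / m%:R) +i* sin (2%:R * pi / m%:R).

Definition monomial g : Prop :=
  (forall i, exists! j, g i j != 0) /\ (forall j, exists! i, g i j != 0).

Definition Gmpn : set 'M[R[i]]_n :=
  [set g | [/\ monomial g,
               forall i j, g i j != 0 -> g i j ^+ m = 1 &
               (\prod_(ij : 'I_n * 'I_n | g ij.1 ij.2 != 0) g ij.1 ij.2)
                 ^+ (m %/ p) = 1]].

(* [mx_perm g] and [mx_exp g] are the u and the a in g = [u; (a_1, ..., a_n)];
   the default values are never used when g is in G(m,p,n): see [GmpnE] and
   [mx_perm_expE] at the end of this file. *)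
Definition mx_perm g : 'S_n :=
  odflt 1%g [pick u : 'S_n | [forall j, g (u j) j != 0]].

Definition mx_exp g (j : 'I_n) : Zmod m :=
  odflt 0 [pick a : Zmod m | g (mx_perm g j) j == omega ^+ a].

Definition weight g : Zmod m := \sum_(j < n) mx_exp g j.

Definition cycles g : {set {set 'I_n}} := porbits (mx_perm g).

Definition cycle_weight g (c : {set 'I_n}) : Zmod m :=
  \sum_(j in c) mx_exp g j.

Definition cycles_weight g (S : {set {set 'I_n}}) : Zmod m :=
  \sum_(c in S) cycle_weight g c.

(* [eigenspace] acts on row vectors, hence the transpose: its rows are the
   transposes of the v in C^n such that t v = v. *)
Definition is_reflection t : Prop := \rank (eigenspace t^T 1) = n.-1.

Definition refl_factorization f g : Prop :=
  (forall t, t \in f -> Gmpn t /\ is_reflection t) /\ \prod_(t <- f) t = g.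

Definition shortest_refl_factorization f g : Prop :=
  refl_factorization f g /\
  forall f', refl_factorization f' g -> (size f <= size f')%N.

Definition mx_subgroup (H : set 'M[R[i]]_n) : Prop :=
  [/\ forall A, H A -> A \in unitmx,
      H 1%:M,
      forall A B, H A -> H B -> H (A *m B) &
      forall A, H A -> H (invmx A)].

Definition generated_subgroup f : set 'M[R[i]]_n :=
  smallest mx_subgroup [set` f].

End Monomial.

Lemma omegaX (R : realType) m k :
  omega R m ^+ k = cos (2%:R * pi / m%:R * k%:R) +i* sin (2%:R * pi / m%:R * k%:R).
Proof.
elim: k => [|k IH]; first by rewrite mulr0 cos0 sin0.
have -> : 2%:R * pi / m%:R * k.+1%:R = 2%:R * pi / m%:R * k%:R + 2%:R * pi / m%:R :> R.
  by rewrite -(addn1 k) natrD; ring.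
rewrite exprSr IH cosD sinD /omega.
apply/eqP; rewrite eq_complex /=; apply/andP; split; apply/eqP; ring.
Qed.

Lemma omega_prim (R : realType) m : (0 < m)%N -> m.-primitive_root (omega R m).
Proof.
move=> m0.
have mN : m%:R != 0 :> R by rewrite pnatr_eq0 -lt0n.
have w1 : omega R m ^+ m = 1.
  rewrite omegaX divfK // mulr_natl cos2pi sin2pi //.
have [d dp dm] := prim_order_exists m0 w1.
have d0 := prim_order_gt0 dp.
have [dE|dNm] := eqVneq d m; first by rewrite -{1}dE.
have ltdm : (d < m)%N by rewrite ltn_neqAle dNm dvdn_leq.
have := prim_expr_order dp; rewrite omegaX => -[h _].
pose x : R := pi * (d%:R / m%:R).
have xE : 2%:R * pi / m%:R * d%:R = x *+ 2 by rewrite /x -mulr_natl; field.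
have : 0 < sin x.
  apply: sin_gt0_pi; have p0 := pi_gt0 R.
  have q0 : 0 < d%:R / m%:R :> R by rewrite divr_gt0 // ltr0n.
  have q1 : d%:R / m%:R < 1 :> R by rewrite ltr_pdivrMr ?ltr0n // mul1r ltr_nat.
  by rewrite /x mulr_gt0 //= gtr_pMr.
move: h; rewrite xE cos_mulr2n cos2sin2 -mulr_natl => h sp.
have := exprn_gt0 2 sp; rewrite expr2 in h *; lra.
Qed.

Lemma GmpnE (R : realType) (m p n : nat) (g : 'M[R[i]]_n) :
  (0 < m)%N -> Gmpn m p g ->
  g = \matrix_(i, j) (if i == mx_perm g j then omega R m ^+ mx_exp m g j else 0).
Proof.
move=> m0 [[hr hc] hm _].
have [s sP] : exists s : 'I_n -> 'I_n, forall j i, (g i j != 0) = (i == s j).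
  have h j : exists i, forall i', (g i' j != 0) = (i' == i).
    have [i [gi iu]] := hc j; exists i => i'.
    by apply/idP/eqP => [/iu //|->].
  by have [s sP] := choice h; exists s.
have s_inj : injective s.
  move=> j k jk; have [l [gl lu]] := hr (s j).
  by rewrite -(lu j) ?sP // -(lu k) // sP jk.
have uP j : g (mx_perm g j) j != 0.
  rewrite /mx_perm; case: pickP => [u /forallP //|/(_ (perm s_inj))] /negP[].
  by apply/forallP => k; rewrite permE sP.
apply/matrixP => i j; rewrite mxE; case: ifP => [/eqP->|iu].
  rewrite /mx_exp; case: pickP => [a /eqP //|].
  have [k ->] := prim_rootP (omega_prim R m0) (hm _ _ (uP j)).
  have km : (k < m.-1.+1)%N by rewrite prednK.
  by move=> /(_ (Ordinal km)); rewrite eqxx.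
apply/eqP; apply: contraFT iu; rewrite sP => /eqP->.
by have := uP j; rewrite sP => /eqP ->.
Qed.

Lemma mx_perm_expE (R : realType) (m n : nat) (u : 'S_n) (a : 'I_n -> Zmod m) :
  (0 < m)%N ->
  let g := \matrix_(i, j) (if i == u j then omega R m ^+ a j else 0) in
  mx_perm g = u /\ mx_exp m g =1 a.
Proof.
move=> m0 g; have wp := omega_prim R m0.
have w0 k : omega R m ^+ k != 0.
  rewrite expf_neq0 //; apply/eqP => w0; have /eqP := prim_expr_order wp.
  by rewrite w0 expr0n eqn0Ngt m0 /= eq_sym oner_eq0.
have uE : mx_perm g = u.
  rewrite /mx_perm; case: pickP => [v /forallP h|/(_ u)] /=; last first.
    by move=> /negP[]; apply/forallP => j; rewrite mxE eqxx.
  apply/permP => j; have := h j; rewrite mxE.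
    by case: (v j =P u j) => // _ /negP[].
split=> // j; rewrite /mx_exp uE mxE eqxx; case: pickP => [b|/(_ (a j))] /=.
  rewrite (eq_prim_root_expr wp) => h; apply/val_inj; apply/eqP; rewrite eq_sym.
  have lt (x : Zmod m) : (x < m)%N by rewrite -[X in (_ < X)%N](prednK m0).
  by move: h; rewrite /= !modn_small.
by rewrite eqxx.
Qed.

(* Main.v *)
Require Import Defs.
From HB Require Import structures.
From mathcomp Require Import all_boot all_order all_algebra all_fingroup.
From mathcomp Require Import cyclic zify.
From mathcomp Require Import complex.
From mathcomp Require Import boolp classical_sets reals trigo.

(** A monomial matrix [u; a] is treated as the element [(u, a)] of the wreath
    product of Z/m by the symmetric group. Its reflections are the
    transpositions with opposite labels at the two moved points, which are the
    edges of a graph on the points, and the diagonal elements with one nonzero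
    label, a multiple of [p]. Write [c] for the number of cycles of [g] and
    [w] for its weight.

    If the three conditions hold, then every reflection factorization of [g]
    generates the group. A union of components of its graph has a weight
    divisible by [p], since only diagonal factors contribute to it, and so the
    graph is connected by the third condition
    ([no_proper_multiple_connected]). Up to conjugation by a diagonal element
    ([gauge_exists]) the generated group then contains all permutations, and
    it is determined by its diagonal elements. The residues [b] for which it
    contains the diagonal elements with labels [b] and [- b] form a subgroup
    that contains all cycle weights of [g], so by the first condition they are
    all of Z/m; together with the second one this gives all elements of total
    weight in pZ/mZ ([connected_generates]).

    Conversely, let a shortest factorization generate the group. Its graph is
    connected, and [g] can be written with at most [n + c - 2] transpositions
    and at most one diagonal reflection, which is needed only if [w] is
    nonzero ([factor_whole]). On the other hand a connected factorization has
    at least [n + c - 2] transpositions ([size_edges_ge]). Hence it has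
    exactly that many, and at most one diagonal factor, of label [w]; this
    implies the second condition. For the third, if the weight of a nontrivial
    set of cycles were divisible by [p], the two parts of [g] could be
    factored separately, and by the second condition the result would be
    shorter ([factor_split]). For the first, the equality case of the lower
    bound is rigid: if the cycle weights all vanish modulo a prime [q], then
    modulo [q] the labels of the transpositions are the differences of a
    potential on the points, and this is inherited by the generated group but
    fails for the whole group. The lower bound and its rigidity are one
    dimension count in linear algebra over a field ([genus_zero_rigidity]);
    they are the genus zero case of the Riemann-Hurwitz formula, with the
    vanishing of the first cohomology of the sphere. *)

Set Implicit Arguments.
Unset Strict Implicit.
Unset Printing Implicit Defensive.

Import Order.TTheory GRing.Theory Num.Theory.

Local Open Scope ring_scope.
Local Open Scope complex_scope.

(** * The wreath product of Z/m and the symmetric group *)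

Section Stable.
Variable n : nat.
Implicit Types (u v : 'S_n) (S c : {set 'I_n}).

Definition stable (S : {set 'I_n}) u := [forall j, (u j \in S) == (j \in S)].

Lemma stableP S u : reflect (forall j, (u j \in S) = (j \in S)) (stable S u).
Proof. by apply: (iffP forallP) => h j; apply/eqP; rewrite h. Qed.

Lemma stable1 S : stable S 1.
Proof. by apply/stableP => j; rewrite perm1. Qed.

Lemma stableM S u v : stable S u -> stable S v -> stable S (u * v)%g.
Proof. by move=> /stableP h /stableP k; apply/stableP => j; rewrite permM k h. Qed.

Lemma sum_stable (V : zmodType) S u (f : 'I_n -> V) :
  stable S u -> \sum_(j in S) f (u j) = \sum_(j in S) f j.
Proof.
move=> /stableP h; rewrite [RHS](reindex_inj (@perm_inj _ u)) /=.
by apply: eq_bigl => j; rewrite h.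
Qed.

Lemma stable_porbit u c : c \in porbits u -> stable c u.
Proof.
case/imsetP => x _ ->; apply/stableP => j.
by rewrite -!eq_porbit_mem (porbit_perm u 1).
Qed.

Lemma stable_sub_porbit S u i : stable S u -> i \in S -> porbit u i \subset S.
Proof.
move=> /stableP h iS; apply/fintype.subsetP => y /porbitP[k ->].
by rewrite permX; elim: k => [|k ih] //=; rewrite h.
Qed.

(** The graph with an edge from [e.1.1] to [e.1.2] for each [e] is connected:
    no proper nonempty vertex set is a union of components. In this form,
    connectedness can be tested on the level sets of a function. *)
Definition connected (T : Type) (es : seq ('I_n * 'I_n * T)) := forall S,
  all (fun e => (e.1.1 \in S) == (e.1.2 \in S)) es ->
  S = finset.set0 \/ S = finset.setT.

End Stable.

(** A pair [(u, a)] stands for the monomial matrix whose entry in column [j] has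
    exponent [a j] and sits in row [u j]. *)
Definition wreath (A : finZmodType) (n : nat) : Type :=
  ('S_n * {ffun 'I_n -> A})%type.

HB.instance Definition _ (A : finZmodType) n := Finite.on (wreath A n).

Section Wreath.
Variables (A : finZmodType) (n : nat).
Implicit Types (x y : wreath A n) (u v : 'S_n) (d : {ffun 'I_n -> A}) (S : {set 'I_n}).

Definition wreath_one : wreath A n := (1%g, 0).
(** The product of matrices applies the right factor first, whereas [v * u] in
    ['S_n] is the permutation that applies [v] first; hence the reversed order
    of the permutation parts. *)
Definition wreath_mul x y : wreath A n :=
  ((y.1 * x.1)%g, [ffun j => x.2 (y.1 j) + y.2 j]).
Definition wreath_inv x : wreath A n :=
  ((x.1^-1)%g, [ffun j => - x.2 (x.1^-1 j)%g]).

Lemma wreath_mulA : associative wreath_mul.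
Proof.
move=> x y z; congr pair => /=; first by rewrite mulgA.
by apply/ffunP => j; rewrite !ffunE /= permM addrA.
Qed.

Lemma wreath_mul1 : left_id wreath_one wreath_mul.
Proof.
case=> u d; congr pair => /=; first by rewrite mulg1.
by apply/ffunP => j; rewrite !ffunE /= add0r.
Qed.

Lemma wreath_mulV : left_inverse wreath_one wreath_inv wreath_mul.
Proof.
case=> u d; congr pair => /=; first by rewrite mulgV.
by apply/ffunP => j; rewrite !ffunE /= permK addNr.
Qed.

HB.instance Definition _ :=
  Finite_isGroup.Build (wreath A n) wreath_mulA wreath_mul1 wreath_mulV.

Lemma perm_wreathM x y : (x * y)%g.1 = (y.1 * x.1)%g. Proof. by []. Qed.
Lemma lab_wreathM x y j : (x * y)%g.2 j = x.2 (y.1 j) + y.2 j.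
Proof. by rewrite ffunE. Qed.
Lemma lab_wreath1 j : (1%g : wreath A n).2 j = 0.
Proof. by rewrite ffunE. Qed.

Lemma wreathP x y : x.1 = y.1 -> x.2 =1 y.2 -> x = y.
Proof. by case: x y => [u d] [v e] /= -> /ffunP ->. Qed.

Definition diagw d : wreath A n := (1%g, d).

Lemma diagwD d e : diagw (d + e) = (diagw d * diagw e)%g.
Proof.
apply: wreathP; first by rewrite perm_wreathM mulg1.
by move=> j; rewrite lab_wreathM !ffunE /= perm1.
Qed.

Lemma diagw0 : diagw 0 = 1%g. Proof. by []. Qed.

Lemma diagwN d : diagw (- d) = (diagw d)^-1%g.
Proof. by apply/eqP; rewrite eq_sym eq_invg_mul -diagwD subrr. Qed.

(** The conjugate of the permutation [u] by the diagonal element with exponents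
    [phi]. The elements of this form are the gauge transforms of ['S_n]; their
    cycle weights all vanish. *)
Definition twist (phi : 'I_n -> A) u : wreath A n :=
  (u, [ffun j => phi (u j) - phi j]).

Lemma twistM phi u v : twist phi (u * v)%g = (twist phi v * twist phi u)%g.
Proof.
apply: wreathP => //= j; rewrite !ffunE /= permM.
by rewrite addrA subrK.
Qed.

Lemma twist1 phi : twist phi 1 = 1%g.
Proof. by apply: wreathP => //= j; rewrite !ffunE perm1 subrr. Qed.

Lemma twistV phi u : twist phi u^-1 = (twist phi u)^-1%g.
Proof. by apply/eqP; rewrite eq_sym eq_invg_mul -twistM mulVg twist1. Qed.

(** What remains of the labels of [x] once the gauge transform of its permutation
    is split off: see [twist_defect]. *)
Definition defect (phi : 'I_n -> A) x : {ffun 'I_n -> A} :=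
  [ffun j => x.2 j - (phi (x.1 j) - phi j)].

Lemma twist_defect phi x : x = (twist phi x.1 * diagw (defect phi x))%g.
Proof.
apply: wreathP => [|j]; first by rewrite perm_wreathM mul1g.
by rewrite lab_wreathM /= perm1 !ffunE addrC subrK.
Qed.

Lemma defectM phi x y j :
  defect phi (x * y)%g j = defect phi x (y.1 j) + defect phi y j.
Proof.
rewrite !ffunE /= permM [RHS]addrACA -opprD; congr (_ - _).
by rewrite addrA subrK.
Qed.

Lemma defect1 phi j : defect phi 1%g j = 0.
Proof. by rewrite !ffunE perm1 subrr subr0. Qed.

Lemma diagw_twistJ phi u d :
  (twist phi u * diagw d * (twist phi u)^-1)%g = diagw [ffun j => d (u^-1 j)%g].
Proof.
rewrite -twistV; apply: wreathP => [|j]; first by rewrite !perm_wreathM mul1g mulVg.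
rewrite !lab_wreathM !ffunE /= perm1 permKV.
by rewrite (addrC (_ - _)) -addrA [X in _ + X]addrA subrK subrr addr0.
Qed.

(** One formula for the labels of both kinds of reflections. If [e = (i, j, a)]
    with [i != j], then [refl e] is a transposition with opposite labels; if
    [i = j], then it is diagonal with the single label [a], because the first
    test wins and [tperm i i = 1]. *)
Definition dipole (e : 'I_n * 'I_n * A) : {ffun 'I_n -> A} :=
  [ffun k => if k == e.1.1 then e.2 else if k == e.1.2 then - e.2 else 0].

Definition refl (e : 'I_n * 'I_n * A) : wreath A n :=
  (tperm e.1.1 e.1.2, dipole e).

Lemma twist_tperm phi i j : twist phi (tperm i j) = refl (i, j, phi j - phi i).
Proof.
apply: wreathP => //= k; rewrite !ffunE /=.
case: tpermP => [->|->|/eqP/negPf-> /eqP/negPf->]; rewrite ?eqxx //; last exact: subrr.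
by case: eqP => [->|_]; rewrite ?opprB ?subrr.
Qed.

Definition wt (S : {set 'I_n}) x : A := \sum_(j in S) x.2 j.

Lemma stable_prod S (ts : seq (wreath A n)) :
  all (fun t => stable S t.1) ts -> stable S (\prod_(t <- ts) t)%g.1.
Proof.
elim: ts => [|t ts ih] /=; first by rewrite big_nil stable1.
by case/andP => h /ih k; rewrite big_cons perm_wreathM stableM.
Qed.

(** Weights of a set are additive as long as the permutations preserve the set:
    the labels of the left factor are merely permuted within it. *)
Lemma wtM S x y : stable S y.1 -> wt S (x * y)%g = wt S x + wt S y.
Proof.
move=> h; rewrite /wt -(sum_stable x.2 h) -big_split /=.
by apply: eq_bigr => j _; rewrite lab_wreathM.
Qed.

Lemma wt1 S : wt S 1%g = 0.
Proof. by rewrite /wt big1 // => j _; rewrite lab_wreath1. Qed.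

Lemma wt_prod S (ts : seq (wreath A n)) :
  all (fun t => stable S t.1) ts ->
  wt S (\prod_(t <- ts) t)%g = \sum_(t <- ts) wt S t.
Proof.
elim: ts => [|t ts ih] /=; first by rewrite !big_nil wt1.
by case/andP => h k; rewrite !big_cons wtM ?ih ?stable_prod.
Qed.

Lemma wt_refl S i j a :
  wt S (refl (i, j, a)) =
    if i == j then if i \in S then a else 0
    else (if i \in S then a else 0) - (if j \in S then a else 0).
Proof.
have sd k b : \sum_(l in S) (if l == k then b else 0) = if k \in S then b else 0 :> A.
  rewrite -big_mkcondr /=; case: ifP => kS.
    by rewrite (big_pred1 k) // => l; rewrite andb_idl // => /eqP->.
  by rewrite big_pred0 // => l; apply/negP => /andP[lS /eqP h]; rewrite h kS in lS.
rewrite -!sd /wt; case: eqP => [->|ij].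
  by apply: eq_bigr => k _; rewrite ffunE /=; case: (k == j).
rewrite -sumrB; apply: eq_bigr => k _; rewrite ffunE /=.
by have [->|_] := eqVneq k i; rewrite ?sub0r ?(introF eqP ij) ?subr0 //; case: (k == j); rewrite ?oppr0.
Qed.

Lemma wt_twist phi S u : stable S u -> wt S (twist phi u) = 0.
Proof.
move=> h; rewrite /wt (eq_bigr (fun j => phi (u j) - phi j)); last by move=> j _; rewrite ffunE.
by rewrite sumrB (sum_stable _ h) subrr.
Qed.

Lemma wt_defect phi S x : stable S x.1 -> wt S (diagw (defect phi x)) = wt S x.
Proof.
move=> h; rewrite [in RHS](twist_defect phi x) wtM ?stable1 //.
by rewrite wt_twist // add0r.
Qed.

End Wreath.

(** * Short factorizations *)

Section Upper.
Variables (A : finZmodType) (n : nat).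
Implicit Types (u : 'S_n) (S X : {set 'I_n}) (d : {ffun 'I_n -> A}).

(** Cutting a fixed point off a nontrivial cycle costs one transposition and
    creates one cycle, so [n - c] transpositions suffice for a permutation with
    [c] cycles. *)
Lemma perm_prod_tperm (phi : 'I_n -> A) u :
  exists es : seq ('I_n * 'I_n),
    [/\ (size es + #|porbits u| = n)%N, all (fun e => e.1 != e.2) es &
        twist phi u = (\prod_(e <- es) twist phi (tperm e.1 e.2))%g].
Proof.
have cn (v : 'S_n) : (#|porbits v| <= n)%N by rewrite -[leqRHS]card_ord; apply: leq_imset_card.
have [k] := ubnP (n - #|porbits u|); elim: k u => // k ih u uk.
have [h|] := boolP [forall x, u x == x].
  have -> : u = 1%g by apply/permP => x; rewrite perm1; apply/eqP/(forallP h).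
  exists [::]; split=> //; last by rewrite big_nil twist1.
  rewrite add0n /porbits card_imset ?card_ord // => x y /eqP.
  by rewrite eq_porbit_mem => /porbitP[i ->]; rewrite expg1n perm1.
rewrite negb_forall => /existsP[x ux].
have := porbits_mul_tperm u x (u x).
rewrite porbit_sym (mem_porbit u 1) eq_sym ux /= addn0 addn1.
set v := (_ * u)%g => vu'.
have {vu'}vu : #|porbits v| = #|porbits u|.+1 by [].
have [|es [es1 es2 es3]] := ih v; first by have := cn v; lia.
exists (rcons es (x, u x)); split.
- by rewrite size_rcons addSnnS -vu.
- by rewrite all_rcons es2 andbT /= eq_sym.
rewrite -cats1 big_cat big_seq1 /= -es3 -twistM.
by congr twist; rewrite /v mulgA tperm2 mul1g.
Qed.

(** By a gauge transform, all the weight of a cycle can be moved to a single one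
    of its points. The potential [phi] sums the labels along the cycle from a root
    on, so the defect can only be nonzero at the point [j] where the cycle closes
    up, that is, where [u j] is the root. *)
Lemma cycle_gauge (x : wreath A n) :
  exists (phi : 'I_n -> A) (X : {set 'I_n}),
    [/\ (#|X| <= #|porbits x.1|)%N,
        forall S, stable S x.1 -> S != finset.set0 -> S :&: X != finset.set0 &
        forall j, j \notin X -> defect phi x j = 0].
Proof.
set u := x.1; pose r := froot u.
have symu := fconnect_sym (@perm_inj _ u).
have rc j : fconnect u (r j) j by rewrite symu connect_root.
have ru j : r (u j) = r j.
  by apply/(fingraph.rootP symu); rewrite symu fconnect1.
pose phi j := \sum_(i < findex u (r j) j) x.2 (iter i u (r j)).
exists phi, [set j | u j == r j]; split.
- rewrite -(card_in_imset (f := porbit u)); last first.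
    move=> j k; rewrite !inE => /eqP uj /eqP uk /eqP.
    rewrite eq_porbit_mem => /porbitP[i jk].
    apply: (@perm_inj _ u); rewrite uj uk; apply/(fingraph.rootP symu).
    by rewrite symu jk permX fconnect_iter.
  by apply: subset_leq_card; apply/fintype.subsetP => c /imsetP[j _ ->]; apply: imset_f.
- move=> S /stableP Su /set0Pn[j jS]; apply/set0Pn.
  have rS : r j \in S.
    rewrite -(iter_findex (x := j) (y := r j) (f := u)) ?connect_root //.
    by elim: (findex _ _ _) => //= i; rewrite Su.
  exists (u^-1 (r j))%g; rewrite !inE permKV -{1}Su permKV rS /=.
  by rewrite -(ru (u^-1 (r j))%g) permKV /r (root_root symu).
move=> j; rewrite inE => uj; rewrite ffunE -/u.
rewrite /phi ru; set k := findex u (r j) j.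
have kj : iter k u (r j) = j by apply: iter_findex.
have -> : findex u (r j) (u j) = k.+1.
  rewrite -{2}kj -iterS findex_iter //.
  have := findex_max (rc j); rewrite leq_eqVlt => /orP[/eqP h|//].
  case/eqP: uj; rewrite -{1}kj -iterS -/k.
  by rewrite h iter_order //; apply: perm_inj.
by rewrite big_ord_recr /= kj addrAC subrr add0r subrr.
Qed.

Variable dv : {pred A}.

(** The triples that encode a reflection of the group whose diagonal elements have
    a total weight in [dv]. *)
Definition is_refl_code (e : 'I_n * 'I_n * A) :=
  (e.1.1 != e.1.2) || ((e.2 != 0) && (e.2 \in dv)).

Definition wprod (es : seq ('I_n * 'I_n * A)) : wreath A n :=
  (\prod_(e <- es) refl e)%g.

Lemma wprod_cat es fs : wprod (es ++ fs) = (wprod es * wprod fs)%g.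
Proof. by rewrite /wprod big_cat. Qed.

(** Two transpositions with the same support differ by a diagonal element of total
    weight 0. *)
Lemma diagw_dipole i j a : i != j ->
  diagw (dipole (i, j, a)) = wprod [:: (i, j, - a); (i, j, 0 : A)].
Proof.
move=> ij; have ji : j == i = false by rewrite eq_sym (negPf ij).
rewrite /wprod big_cons big_seq1; apply: wreathP.
  by rewrite perm_wreathM /= tperm2.
move=> k; rewrite lab_wreathM /= !ffunE /= oppr0 !if_same addr0 opprK.
by case: tpermP => [->|->|/eqP/negPf-> /eqP/negPf->] //; rewrite !eqxx ?ji.
Qed.

Lemma prod_dipole r (d : 'I_n -> A) js : r \notin js ->
  exists es, [/\ all is_refl_code es, size es = (size js).*2 &
    wprod es = diagw (\sum_(j <- js) dipole (j, r, d j))].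
Proof.
elim: js => [|j js ih]; first by exists [::]; rewrite /wprod !big_nil.
rewrite inE negb_or eq_sym => /andP[jr /ih[es [es1 es2 es3]]].
exists ([:: (j, r, - d j); (j, r, 0)] ++ es); split.
- by rewrite all_cat es1 /= /is_refl_code jr.
- by rewrite size_cat es2.
by rewrite big_cons diagwD -es3 wprod_cat diagw_dipole.
Qed.

(** All labels are pushed to one point [r] of the support, at the price of two
    transpositions per other point; a diagonal reflection is needed only if the
    total weight, which then sits at [r], is nonzero. *)
Lemma prod_diagw d X : X != finset.set0 -> (forall j, j \notin X -> d j = 0) ->
  \sum_j d j \in dv ->
  exists es, [/\ all is_refl_code es, (size es + 2 <= #|X|.*2 + ((\sum_j d j)%R != 0%R))%N &
    wprod es = diagw d].
Proof.
case/set0Pn => r rX dX ddv; set w := \sum_j d j in ddv *.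
have [|es [es1 es2 es3]] := @prod_dipole r d (enum (X :\ r)).
  by rewrite mem_enum !inE eqxx.
(* At r, the labels - d j cancel all of the total w except d r. *)
have dE : \sum_(j <- enum (X :\ r)) dipole (j, r, d j) + dipole (r, r, w) = d.
  apply/ffunP => k; rewrite !ffunE sum_ffunE big_enum /=.
  have [->|kr] := eqVneq k r.
    rewrite (eq_bigr (fun j => - d j)); last first.
      by move=> j; rewrite !inE ffunE /= eqxx (eq_sym r j) => /andP[/negPf->].
    have -> : w = d r + \sum_(j in X :\ r) d j.
      rewrite /w (bigD1 r) //=; congr (_ + _); rewrite [LHS](bigID (mem X)) /=.
      rewrite [X in _ + X]big1 ?addr0; last by move=> j /andP[_ /dX].
      by apply: eq_bigl => j; rewrite !inE.
    by rewrite sumrN addrC addrK.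
  rewrite addr0; have [kX|kX] := boolP (k \in X); last first.
    rewrite dX // big1 // => j; rewrite !inE ffunE /= (negPf kr) => /andP[_ jX].
    by case: eqP => // kj; rewrite kj jX in kX.
  rewrite (bigD1 k) ?inE ?kr //= ffunE /= eqxx big1 ?addr0 // => j.
  by rewrite !inE ffunE /= (negPf kr) (eq_sym k j) => /andP[_ /negPf->].
have cX : #|X| = (size (enum (X :\ r))).+1 by rewrite -cardE (cardsD1 r) rX.
have [w0|w0] := eqVneq w 0.
  exists es; split=> //; first by rewrite es2 cX doubleS addn2 leq_addr.
  rewrite es3 -[in RHS]dE w0 diagwD -[LHS]mulg1; congr (_ * _)%g.
  by rewrite -diagw0; congr diagw; apply/ffunP => k; rewrite !ffunE oppr0 !if_same.
exists (rcons es (r, r, w)); split.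
- by rewrite all_rcons es1 /is_refl_code /= eqxx w0 ddv.
- by rewrite size_rcons es2 cX doubleS addn2 addn1.
rewrite -cats1 wprod_cat es3 -[in RHS]dE diagwD /wprod big_seq1 /refl /=.
by rewrite tperm1.
Qed.

Lemma prod_twist phi u : exists es,
  [/\ all is_refl_code es, (size es + #|porbits u| = n)%N & wprod es = twist phi u].
Proof.
have [es [es1 es2 es3]] := perm_prod_tperm phi u.
exists [seq (e.1, e.2, phi e.2 - phi e.1) | e <- es]; split.
- by rewrite all_map; apply: sub_all es2 => e; rewrite /is_refl_code /= => ->.
- by rewrite size_map.
by rewrite /wprod big_map es3; apply: eq_bigr => e _; rewrite twist_tperm.
Qed.

(** With all cycles in one block: [n - c] transpositions for the permutation,
    [2 (c - 1)] more and perhaps a diagonal reflection for the cycle weights. *)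
Lemma factor_whole (x : wreath A n) : (0 < n)%N -> wt [set: 'I_n] x \in dv ->
  exists es, [/\ all is_refl_code es,
    (size es + 2 <= n + #|porbits x.1| + (wt [set: 'I_n] x != 0%R))%N &
    wprod es = x].
Proof.
move=> n0; have sT : stable [set: 'I_n] x.1 by apply/stableP => j; rewrite !inE.
have [phi [X [X1 X2 X3]]] := cycle_gauge x.
have /X2 := sT; rewrite finset.setTI => X4.
have [es [es1 es2 es3]] := prod_twist phi x.1.
rewrite -(wt_defect phi sT) => xdv.
have wE : wt [set: 'I_n] (diagw (defect phi x)) = \sum_j defect phi x j.
  by apply: eq_bigl => j; rewrite inE.
have [||fs [fs1 fs2 fs3]] := @prod_diagw (defect phi x) X _ X3.
- by apply: X4; apply/set0Pn; exists (Ordinal n0).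
- by rewrite -wE.
exists (es ++ fs); split; first by rewrite all_cat es1.
  rewrite size_cat wE; move: es2 fs2 X1.
  by move: (nat_of_bool _) #|X| #|porbits x.1| => b c k; lia.
by rewrite wprod_cat es3 fs3 -twist_defect.
Qed.

(** With two blocks of admissible weights, two transpositions are saved, and a
    diagonal reflection may be needed in each block. *)
Lemma factor_split (x : wreath A n) S : stable S x.1 ->
  S != finset.set0 -> ~: S != finset.set0 ->
  wt S x \in dv -> wt (~: S) x \in dv ->
  exists es, [/\ all is_refl_code es,
    (size es + 4 <= n + #|porbits x.1| + (wt S x != 0%R) + (wt (~: S) x != 0%R))%N &
    wprod es = x].
Proof.
move=> sS S0 SC0.
have sSC : stable (~: S) x.1 by apply/stableP => j; rewrite !inE (stableP _ _ sS).
have [phi [X [X1 X2 X3]]] := cycle_gauge x.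
have [es [es1 es2 es3]] := prod_twist phi x.1.
pose d (U : {set 'I_n}) := [ffun j => if j \in U then defect phi x j else 0].
have dE U : stable U x.1 -> \sum_j d U j = wt U x.
  move=> sU; rewrite -(wt_defect phi sU) /wt [RHS]big_mkcond.
  by apply: eq_bigr => j _; rewrite ffunE.
have d0 U j : j \notin U :&: X -> d U j = 0.
  by rewrite !inE ffunE; case: (j \in U) => //= /X3.
move=> w1 w2.
have [||fs [fs1 fs2 fs3]] := @prod_diagw (d S) (S :&: X) _ (d0 S).
- exact: X2.
- by rewrite dE.
have [||hs [hs1 hs2 hs3]] := @prod_diagw (d (~: S)) (~: S :&: X) _ (d0 _).
- exact: X2.
- by rewrite dE.
have cX := cardsID S X; rewrite finset.setIC in cX.
rewrite finset.setDE (finset.setIC X) in cX.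
rewrite !dE // in fs2 hs2.
exists (es ++ fs ++ hs); split; first by rewrite !all_cat es1 fs1.
  rewrite !size_cat; move: es2 fs2 hs2 X1 cX.
  move: (nat_of_bool (wt S x != 0)) (nat_of_bool (wt (~: S) x != 0)) => b b'.
  by move: #|S :&: X| #|~: S :&: X| #|X| #|porbits x.1| => k1 k2 k c; lia.
rewrite !wprod_cat es3 fs3 hs3 -diagwD [RHS](twist_defect phi).
congr (_ * diagw _)%g; apply/ffunP => j; rewrite !ffunE !inE.
by case: (j \in S); rewrite ?addr0 ?add0r.
Qed.

End Upper.

(** * Genus zero factorizations over a field *)

Section Rigid.
Variables (F : fieldType) (n : nat).
Implicit Types (es : seq ('I_n * 'I_n * F)) (y phi : 'I_n -> F) (S c : {set 'I_n}).

Fixpoint perm_of_edges es : 'S_n :=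
  if es is e :: es' then (perm_of_edges es' * tperm e.1.1 e.1.2)%g else 1%g.

(** The matrix of the coboundary map, from potentials on the vertices to labels on
    the edges. *)
Fixpoint edge_coef es k j : F :=
  match es, k with
  | [::], _ => 0
  | e :: _, 0 => (j == e.1.2)%:R - (j == e.1.1)%:R
  | _ :: es', k'.+1 => edge_coef es' k' j
  end.

(** The labels of a product of transpositions [e_k] with labels [a_k] depend
    linearly on the [a_k]; [label_coef es k j] is the coefficient of [a_k] in the
    label of column [j]. It is the edge vector of [e_k] transported by the
    permutation of the factors to the right of [e_k]. *)
Fixpoint label_coef es k j : F :=
  match es, k with
  | [::], _ => 0
  | e :: es', 0 => (perm_of_edges es' j == e.1.1)%:R - (perm_of_edges es' j == e.1.2)%:R
  | _ :: es', k'.+1 => label_coef es' k' j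
  end.

Definition label es k : F := nth 0 [seq e.2 | e <- es] k.

Definition label_prod es j : F :=
  \sum_(k < size es) label es k * label_coef es k j.

Lemma label_prod_cons e es j : label_prod (e :: es) j =
  e.2 * ((perm_of_edges es j == e.1.1)%:R - (perm_of_edges es j == e.1.2)%:R) +
  label_prod es j.
Proof. by rewrite /label_prod big_ord_recl. Qed.

Lemma sum_delta y i : \sum_j y j * (j == i)%:R = y i.
Proof.
rewrite (bigD1 i) //= eqxx mulr1 big1 ?addr0 // => j /negPf->.
by rewrite mulr0.
Qed.

Lemma sum_perm_delta y (s : 'S_n) i : \sum_j y j * (s j == i)%:R = y (s^-1 i)%g.
Proof.
rewrite -[RHS]sum_delta; apply: eq_bigr => j _.
by rewrite -[in RHS](inj_eq (@perm_inj _ s)) permKV.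
Qed.

Lemma edge_coef_ker es y :
  (forall k, (k < size es)%N -> \sum_j y j * edge_coef es k j = 0) ->
  all (fun e => y e.1.1 == y e.1.2) es.
Proof.
elim: es => //= e es ih h; rewrite ih ?andbT; last by move=> k /(h k.+1).
have /eqP := h 0 isT; under eq_bigr do rewrite mulrBr.
by rewrite sumrB !sum_delta subr_eq0 eq_sym.
Qed.

(** Going through the factors from right to left, a vector that is killed by all
    transported edge vectors is preserved by all permutations met so far, so it is
    killed by the next edge vector itself. *)
Lemma label_coef_ker es y :
  (forall k, (k < size es)%N -> \sum_j y j * label_coef es k j = 0) ->
  all (fun e => y e.1.1 == y e.1.2) es.
Proof.
suff: (forall k, (k < size es)%N -> \sum_j y j * label_coef es k j = 0) ->
  all (fun e => y e.1.1 == y e.1.2) es /\ forall j, y (perm_of_edges es j) = y j.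
  by move=> H /H[].
elim: es => [|e es ih] h; first by split=> // j; rewrite perm1.
have [k /(h k.+1) //|ih1 ih2] := ih.
have yV i : y ((perm_of_edges es)^-1%g i) = y i by rewrite -ih2 permKV.
have /eqP := h 0 isT; rewrite /=; under eq_bigr do rewrite mulrBr.
rewrite sumrB !sum_perm_delta !yV subr_eq0 => /eqP ye.
split=> [|j] /=; first by rewrite ye eqxx.
by rewrite permM; rewrite -(ih2 j); case: tpermP => [->|->|].
Qed.

(** If the edge labels come from a potential [phi], then every factor is the gauge
    transform of a transposition, and so is the product: its labels are the
    differences of [phi]. *)
Lemma label_coef_potential es phi j :
  \sum_(k < size es) (\sum_i phi i * edge_coef es k i) * label_coef es k j =
  phi (perm_of_edges es j) - phi j.
Proof.
elim: es => [|e es ih]; first by rewrite big_ord0 perm1 subrr.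
rewrite big_ord_recl /= ih permM.
under eq_bigr do rewrite mulrBr.
rewrite sumrB !sum_delta.
set s := perm_of_edges es j.
have [->|ne] := eqVneq e.1.1 e.1.2; first by rewrite !subrr mulr0 add0r tperm1 perm1.
case: tpermP => [->|->|/eqP/negPf-> /eqP/negPf->].
- by rewrite eqxx (negPf ne) subr0 mulr1 addrA subrK.
- by rewrite eqxx eq_sym (negPf ne) sub0r mulrN1 opprB addrA subrK.
by rewrite subrr mulr0 add0r.
Qed.

Lemma connected_const es y : connected es ->
  all (fun e => y e.1.1 == y e.1.2) es -> forall i j, y i = y j.
Proof.
move=> conn h i j; have [||h'] := conn [set k | y k == y j].
- by apply: sub_all h => e /eqP h; rewrite !inE h.
- by move/setP/(_ j); rewrite !inE eqxx.
by have := finset.in_setT i; rewrite -h' inE => /eqP.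
Qed.

(** Constant vectors form a space of dimension at most 1. *)
Lemma rank_ge_const_ker r (M : 'M[F]_(r, n)) :
  (forall y : 'rV_n, y *m M^T = 0 -> forall i j, y 0 i = y 0 j) ->
  (n <= \rank M + 1)%N.
Proof.
move=> h.
have: (kermx M^T <= (const_mx 1 : 'rV[F]_n))%MS.
  apply/row_subP => i; set y := row i _.
  have /h yc : y *m M^T = 0 by apply/sub_kermxP; apply: row_sub.
  case: n M h y yc => [|k] M h y yc; first by rewrite [y]thinmx0 sub0mx.
  have -> : y = y 0 ord0 *: const_mx 1.
    by apply/rowP => j; rewrite [RHS]mxE [X in _ * X]mxE mulr1; apply: yc.
  exact: scalemx_sub.
move/mxrankS; rewrite mxrank_ker mxrank_tr => /leq_trans/(_ (rank_leq_row _)).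
by rewrite leq_subLR addnC.
Qed.

(** Let [E] be the coboundary matrix, [P] the matrix of [label_coef], and [Z] the
    incidence matrix of points and cycles of the product, so that [a *m P *m Z]
    lists the cycle weights of the product for edge labels [a]. Connectedness gives
    [E] and [P] rank at least [n - 1], and [Z] has rank [c]. Since coboundaries yield
    zero cycle weights, the image of [E^T], of dimension at least [n - 1], lies in
    the kernel of [P *m Z], whose dimension is at most
    [size es - (n - 1 + c - n) = size es - c + 1]. This is the inequality
    [n + c - 2 <= size es]. In the case of equality the two spaces coincide: labels
    with zero cycle weights are coboundaries. (It is the fact that a planar surface
    has no first homology besides that generated by its boundary components.) *)
Lemma genus_zero_rigidity es : connected es ->
  (n + #|porbits (perm_of_edges es)| <= size es + 2)%N /\
  ((size es + 2 <= n + #|porbits (perm_of_edges es)|)%N ->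
   (forall c, c \in porbits (perm_of_edges es) -> \sum_(j in c) label_prod es j = 0) ->
   exists phi, forall e, e \in es -> e.2 = phi e.1.2 - phi e.1.1).
Proof.
move=> conn; set u := perm_of_edges es; set r := size es; set c := #|porbits u|.
pose E : 'M[F]_(r, n) := \matrix_(k, j) edge_coef es k j.
pose P : 'M[F]_(r, n) := \matrix_(k, j) label_coef es k j.
pose cyc (k : 'I_c) : {set 'I_n} := enum_val k.
have cycP k : cyc k \in porbits u := enum_valP k.
have cyc_inj : injective cyc := enum_val_inj.
pose Z : 'M[F]_(n, c) := \matrix_(j, k) (j \in cyc k)%:R.
have coef_ker (C : nat -> 'I_n -> F) (y : 'rV_n) :
    y *m (\matrix_(k < r, j < n) C k j)^T = 0 ->
    forall k, (k < r)%N -> \sum_j y 0 j * C k j = 0.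
  move=> /rowP/[swap] k /[swap] kr /(_ (Ordinal kr)); rewrite !mxE => h.
  by rewrite -[RHS]h; apply: eq_bigr => j _; rewrite !mxE.
have rE : (n <= \rank E + 1)%N.
  apply: rank_ge_const_ker => y /coef_ker h; apply: (connected_const conn).
  exact: edge_coef_ker.
have rP : (n <= \rank P + 1)%N.
  apply: rank_ge_const_ker => y /coef_ker h; apply: (connected_const conn).
  exact: label_coef_ker.
(* A choice of one point in each cycle gives a left inverse of Z. *)
have rZ : \rank Z = c.
  rewrite -mxrank_tr; apply/eqP; rewrite -/(row_free _); apply/row_freeP.
  have rep (k : 'I_c) : exists i, porbit u i == cyc k.
    by have /imsetP[i _ ->] := cycP k; exists i.
  exists (\matrix_(j, k) (j == xchoose (rep k))%:R).
  apply/matrixP => k l; rewrite !mxE.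
  rewrite (eq_bigr (fun j => (j \in cyc k)%:R * (j == xchoose (rep l))%:R)); last first.
    by move=> j _; rewrite !mxE.
  rewrite (sum_delta (fun j => (j \in cyc k)%:R)); congr (nat_of_bool _)%:R.
  have /imsetP[i _ ki] := cycP k.
  rewrite ki -eq_porbit_mem (eqP (xchooseP (rep l))) -ki (inj_eq cyc_inj).
  exact: eq_sym.
have EPZ : E^T *m P *m Z = 0.
  apply/matrixP => i k; rewrite -mulmxA !mxE.
  have /(stable_porbit) st := cycP k.
  under eq_bigr => l _ do rewrite !mxE big_distrr /=.
  rewrite exchange_big /=.
  rewrite (eq_bigr (fun j => ((i == u j)%:R - (i == j)%:R) * (j \in cyc k)%:R)); last first.
    move=> j _; rewrite !mxE -(label_coef_potential es (fun k => (i == k)%:R) j).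
    rewrite big_distrl; apply: eq_bigr => l _ /=; rewrite !mxE mulrA.
    congr (_ * _ * _); rewrite -[LHS](sum_delta (edge_coef es l)).
    by apply: eq_bigr => q _; rewrite mulrC eq_sym.
  under eq_bigr => j _ do rewrite mulr_natr mulrb.
  by rewrite -big_mkcond /= sumrB (sum_stable (fun j => (i == j)%:R) st) subrr.
have sub : (E^T <= kermx (P *m Z))%MS by apply/sub_kermxP; rewrite mulmxA.
have rPZ : (n + c <= \rank (P *m Z) + 1 + n)%N.
  have := mxrank_mul_min P Z; rewrite rZ; lia.
have rK : (\rank (kermx (P *m Z)) + \rank (P *m Z) = r)%N.
  by rewrite mxrank_ker subnK // rank_leq_row.
have rEK := mxrankS sub; rewrite mxrank_tr in rEK.
split; first by move: rE rPZ rK rEK; clear; lia.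
move=> rle lab0.
have /submxP[D LD] : ((\row_(k < r) label es k : 'rV[F]_r) <= E^T)%MS.
  have : (kermx (P *m Z) <= E^T)%MS.
    rewrite -(mxrank_leqif_sup sub) mxrank_tr eqn_leq rEK /=.
    by move: rE rPZ rK rle; clear; lia.
  apply: submx_trans; apply/sub_kermxP; rewrite mulmxA; apply/rowP => k.
  rewrite !mxE -[RHS](lab0 _ (cycP k)) [RHS]big_mkcond /=.
  apply: eq_bigr => j _; rewrite !mxE mulr_natr mulrb; case: ifP => // _.
  by apply: eq_bigr => l _; rewrite !mxE.
exists (D 0).
have {LD rle lab0} : forall k, (k < r)%N -> label es k = \sum_j D 0 j * edge_coef es k j.
  move=> k kr; move/rowP/(_ (Ordinal kr)): LD; rewrite !mxE => ->.
  by apply: eq_bigr => j _; rewrite !mxE.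
rewrite /r; clear; elim: es => //= e es ih h f; rewrite inE => /orP[/eqP->|].
  have := h 0%N isT; rewrite /label /= => ->.
  by under eq_bigr do rewrite mulrBr; rewrite sumrB !sum_delta.
by apply: ih => k /(h k.+1).
Qed.

End Rigid.

(** * Groups generated by a connected set of reflections *)

Section Generation.
Variables (A : finZmodType) (n : nat) (H : {group wreath A n}).
Implicit Types (es : seq ('I_n * 'I_n * A)) (d : {ffun 'I_n -> A}) (i j k : 'I_n).
Implicit Types (a b : A) (phi : 'I_n -> A) (y : wreath A n).

Lemma refl_sym i j (a : A) : i != j -> refl (i, j, a) = refl (j, i, - a).
Proof.
move=> ij; apply: wreathP => [|k]; first exact: tpermC.
rewrite !ffunE /= opprK; have [->|//] := eqVneq k i.
by rewrite (negPf ij).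
Qed.

(** After a gauge transform, a connected set of reflections generates a group that
    contains all permutations. The vertices [j] for which the group contains some
    transposition of [i0] and [j] form a union of components, since conjugating by
    an edge at [j] moves [j] along that edge. So all [j] occur; the labels of these
    transpositions define [phi], and the transpositions at [i0] generate ['S_n]. *)
Lemma gauge_exists i0 es : connected es ->
  (forall e, e \in es -> refl e \in H) ->
  exists phi, forall u, twist phi u \in H.
Proof.
move=> conn eH.
pose C := [set j | (j == i0) || [exists a : A, refl (i0, j, a) \in H]].
have step i j a : i \in C -> refl (i, j, a) \in H -> j \in C.
  have [<-//|ij] := eqVneq i j.
  rewrite !inE; have [->//|ji0] := eqVneq j i0.
  have [->|ii0] := eqVneq i i0; first by move=> _ h; apply/existsP; exists a.
  case/existsP => b bH aH; apply/existsP; exists (b + a).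
  (* Both transpositions are gauge transforms by this phi, so their conjugate is as well. *)
  pose phi k : A := if k == i then b else if k == j then b + a else 0.
  have b0 : refl (i0, i, b) = twist phi (tperm i0 i).
    rewrite twist_tperm /phi eqxx eq_sym (negPf ii0).
    by rewrite eq_sym (negPf ji0) subr0.
  have a0 : refl (i, j, a) = twist phi (tperm i j).
    by rewrite twist_tperm /phi !eqxx eq_sym (negPf ij) addrC addKr.
  have -> : refl (i0, j, b + a) = twist phi (tperm i0 j).
    rewrite twist_tperm /phi !(eq_sym j) !(eq_sym i0) (negPf ij) (negPf ii0) (negPf ji0).
    by rewrite eqxx subr0.
  have -> : tperm i0 j = (tperm i j * tperm i0 i * tperm i j)%g.
    have := tpermJ i0 i (tperm i j); rewrite /conjg tpermV mulgA tpermL => ->.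
    by rewrite tpermD // eq_sym.
  by rewrite !twistM -a0 -b0 !groupM.
have CT : C = [set: 'I_n].
  have [||//] := conn C; last by move/setP/(_ i0); rewrite !inE eqxx.
  apply/allP => -[[i j] a] /eH h /=.
  have [->//|ij] := eqVneq i j; apply/eqP; apply/idP/idP => k; first exact: (step _ _ _ k h).
  by apply: (step _ _ (- a) k); rewrite -refl_sym.
have /fin_all_exists[psi psiH] j : exists a, j != i0 -> refl (i0, j, a) \in H.
  have: j \in C by rewrite CT inE.
  by rewrite inE => /orP[/eqP->|/existsP[a aH]]; [exists 0; rewrite eqxx | exists a].
pose phi j := if j == i0 then 0 else psi j.
exists phi => u.
have gU : group_set [set u | twist phi u \in H].
  apply/group_setP; split=> [|v w]; first by rewrite inE twist1.
  by rewrite !inE twistM => hv hw; rewrite groupM.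
have : <<[set tperm i0 j | j in 'I_n]>>%g \subset Group gU.
  rewrite gen_subG; apply/fintype.subsetP => _ /imsetP[j _ ->].
  rewrite inE; have [->|ji0] := eqVneq j i0; first by rewrite tperm1 twist1.
  by rewrite twist_tperm /phi eqxx (negPf ji0) subr0 psiH.
by rewrite gen_tperm => /fintype.subsetP/(_ u); rewrite !inE => ->.
Qed.

Definition spike i (a : A) : {ffun 'I_n -> A} := [ffun k => if k == i then a else 0].

Lemma spikeD i : {morph spike i : a b / a + b}.
Proof. by move=> a b; apply/ffunP => k; rewrite !ffunE; case: ifP; rewrite ?addr0. Qed.

Lemma spike0 i : spike i 0 = 0.
Proof. by apply/ffunP => k; rewrite !ffunE if_same. Qed.

Lemma spike_perm (u : 'S_n) i a :
  [ffun j => spike i a (u^-1 j)%g] = spike (u i) a.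
Proof.
by apply/ffunP => j; rewrite !ffunE -(inj_eq (@perm_inj _ u)) permKV.
Qed.

Lemma dipole_spike i j a :
  dipole (i, j, a) = if i == j then spike i a else spike i a - spike j a.
Proof.
apply/ffunP => k; have [<-|ij] := eqVneq i j; rewrite !ffunE /=; first by case: ifP => // ->.
have [->|_] := eqVneq k i; first by rewrite (negPf ij) subr0.
by case: ifP; rewrite sub0r // oppr0.
Qed.

Lemma defect_refl phi i j a :
  defect phi (refl (i, j, a)) = dipole (i, j, a - (phi j - phi i)).
Proof.
apply/ffunP => k; rewrite !ffunE /=.
have [->|ki] := eqVneq k i; first by rewrite tpermL.
have [->|kj] := eqVneq k j; first by rewrite tpermR !opprB addrC.
by rewrite tpermD 1?eq_sym // subrr subrr.
Qed.

Variables (phi : 'I_n -> A) (phiH : forall u, twist phi u \in H).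

Lemma defect_mem y : (diagw (defect phi y) \in H) = (y \in H).
Proof. by rewrite [in RHS](twist_defect phi y) groupMl. Qed.

Lemma diagw_perm (u : 'S_n) d : diagw d \in H -> diagw [ffun j => d (u^-1 j)%g] \in H.
Proof. by move=> dH; rewrite -(diagw_twistJ phi) !groupM ?groupV. Qed.

(** The residues [b] for which the group contains all diagonal elements with the
    labels [b] and [- b] at two places. *)
Definition balanced : {set A} :=
  [set b | [forall i, forall j, diagw (spike i b - spike j b) \in H]].

Lemma balancedP b :
  reflect (forall i j, diagw (spike i b - spike j b) \in H) (b \in balanced).
Proof.
rewrite inE; apply: (iffP forallP) => h i; last by apply/forallP => j; apply: h.
move=> j; move/forallP: (h i); exact.
Qed.

Lemma balanced_group : group_set balanced.
Proof.
apply/group_setP; split=> [|b c].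
  by apply/balancedP => i j; rewrite !spike0 subrr diagw0 group1.
move=> /balancedP hb /balancedP hc; apply/balancedP => i j.
by rewrite !spikeD opprD addrACA diagwD groupM.
Qed.
Canonical balanced_Group := Group balanced_group.

Lemma balanced0 : 0 \in balanced. Proof. exact: (group1 balanced_Group). Qed.
Lemma balancedN b : b \in balanced -> - b \in balanced.
Proof. exact: (@groupVr _ balanced_Group). Qed.
Lemma balancedD b c : b \in balanced -> c \in balanced -> b + c \in balanced.
Proof. exact: (@groupM _ balanced_Group). Qed.

(** The diagonal part of the group is stable under permutations of the places, so
    one pair of places, or one diagonal reflection, already gives all pairs. *)
Lemma balanced_dipole i j b : diagw (dipole (i, j, b)) \in H -> b \in balanced.
Proof.
rewrite dipole_spike; case: (eqVneq i j) => [_|ij] h.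
  have h' k : diagw (spike k b) \in H.
    by have := diagw_perm (tperm i k) h; rewrite spike_perm tpermL.
  by apply/balancedP => k l; rewrite diagwD diagwN groupM ?groupV.
have h' k : diagw (spike i b - spike k b) \in H.
  have [->|ki] := eqVneq k i; first by rewrite subrr diagw0 group1.
  have ji : j != i by rewrite eq_sym.
  have E1 := spike_perm (tperm j k) i b; rewrite tpermD // in E1.
  have E2 := spike_perm (tperm j k) j b; rewrite tpermL in E2.
  have -> : spike i b - spike k b =
      [ffun l => (spike i b - spike j b) ((tperm j k)^-1 l)%g].
    by rewrite -[LHS](congr2 (fun f g => f - g) E1 E2); apply/ffunP => l; rewrite !ffunE.
  exact: diagw_perm.
apply/balancedP => k l.
have -> : spike k b - spike l b = - (spike i b - spike k b) + (spike i b - spike l b).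
  by rewrite opprB addrA subrK.
by rewrite diagwD diagwN groupM ?groupV.
Qed.

(** Relative to the gauge, all labels of all products of the factors are balanced;
    this bounds the cycle weights of the product, which the gauge leaves alone. *)
Lemma defect_wprod es : (forall e, e \in es -> refl e \in H) ->
  forall j, defect phi (wprod es) j \in balanced.
Proof.
elim: es => [|[[i j] a] es ih] eH k; first by rewrite /wprod big_nil defect1 balanced0.
rewrite /wprod big_cons defectM balancedD //; last first.
  by apply: ih => e ees; apply: eH; rewrite inE ees orbT.
have /eH : (i, j, a) \in (i, j, a) :: es by rewrite inE eqxx.
rewrite -defect_mem defect_refl => /balanced_dipole bB.
rewrite ffunE; case: ifP => // _; case: ifP => _; rewrite ?balancedN ?balanced0 //.
Qed.

Lemma balanced_sum (I : finType) (P : pred I) (f : I -> A) :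
  (forall x, P x -> f x \in balanced) -> \sum_(x | P x) f x \in balanced.
Proof.
move=> h; elim/big_ind: _ => //; [exact: balanced0 | exact: balancedD].
Qed.

(** If all residues are balanced, then the group contains all diagonal elements of
    total weight 0. An arbitrary [y] is reduced to these by removing the permutation
    part and a power of the defect of the product. *)
Lemma balanced_full (i0 : 'I_n) es : (forall e, e \in es -> refl e \in H) ->
  balanced = [set: A] ->
  forall y, wt [set: 'I_n] y \in <[wt [set: 'I_n] (wprod es)]>%g -> y \in H.
Proof.
move=> eH BT.
have wE y : wt [set: 'I_n] y = \sum_j defect phi y j.
  rewrite -(wt_defect phi); last by apply/stableP => j; rewrite !inE.
  by apply: eq_bigl => j; rewrite inE.
have sum0 d : \sum_j d j = 0 -> diagw d \in H.
  move=> d0; have -> : d = \sum_j (spike j (d j) - spike i0 (d j)).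
    have s0 : \sum_j spike i0 (d j) = 0.
      by rewrite -(big_morph (spike i0) (spikeD i0) (spike0 i0)) d0 spike0.
    rewrite sumrB s0 subr0; apply/ffunP => k; rewrite sum_ffunE.
    rewrite (bigD1 k) //= ffunE eqxx big1 ?addr0 // => j jk.
    by rewrite ffunE eq_sym (negPf jk).
  elim/big_ind: _ => [|e f he hf|j _].
  - by rewrite diagw0 group1.
  - by rewrite diagwD groupM.
  - by apply/balancedP; rewrite BT inE.
move=> y /cycleP[k]; rewrite FinRing.zmodXgE !wE => yk.
set x := wprod es in yk.
have xH : x \in H.
  by rewrite /x /wprod big_seq; apply: group_prod => e /eH.
rewrite -defect_mem -[defect phi y](subrK (defect phi x *+ k)) diagwD groupM //.
  apply: sum0; rewrite (eq_bigr (fun j => defect phi y j - defect phi x j *+ k)).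
    by rewrite sumrB yk sumrMnl subrr.
  by move=> j _; rewrite !ffunE ffunMnE ffunE.
elim: k {yk} => [|k ih]; first by rewrite diagw0 group1.
by rewrite mulrS diagwD groupM // defect_mem.
Qed.

End Generation.

(** The cycle weights of the product are balanced residues. If they generate all of
    [A], then the group contains every element with the same total weight as a power
    of the product. *)
Lemma connected_generates (A : finZmodType) n (i0 : 'I_n) (H : {group wreath A n})
    (es : seq ('I_n * 'I_n * A)) :
  connected es -> (forall e, e \in es -> refl e \in H) ->
  <<[set wt c (wprod es) | c in porbits (wprod es).1]>>%g = [set: A] ->
  forall y, wt [set: 'I_n] y \in <[wt [set: 'I_n] (wprod es)]>%g -> y \in H.
Proof.
move=> conn eH gen_refl; have [phi phiH] := gauge_exists i0 conn eH.
apply: (balanced_full phiH i0 eH); apply/eqP; rewrite finset.eqEsubset finset.subsetT -gen_refl.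
rewrite (gen_subG _ (balanced_Group H)).
apply/fintype.subsetP => _ /imsetP[c cP ->].
rewrite -(wt_defect phi (stable_porbit cP)).
by apply: balanced_sum => j _; apply: defect_wprod.
Qed.

(** * Residues modulo m and cycles of a permutation *)

Section Residues.
Variables (m p : nat).
Hypothesis (pm : (p %| m.+1)%N).
Implicit Types (a b : 'I_m.+1).

Lemma dvdn_modulus k : (p %| k %% m.+1)%N = (p %| k)%N.
Proof. by rewrite [in RHS](divn_eq k m.+1) dvdn_addr // dvdn_mull. Qed.

Definition multiples : {pred 'I_m.+1} := [pred a : 'I_m.+1 | (p %| a)%N].

Lemma multiplesD a b : a \in multiples -> b \in multiples -> a + b \in multiples.
Proof. by rewrite !inE /= dvdn_modulus => ha hb; rewrite dvdn_add. Qed.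

Lemma multiplesN a : a \in multiples -> - a \in multiples.
Proof. by rewrite !inE /= dvdn_modulus => ha; rewrite dvdn_sub. Qed.

Lemma multiples0 : 0 \in multiples.
Proof. exact: dvdn0. Qed.

Lemma multiples_sum (T : eqType) (s : seq T) (f : T -> 'I_m.+1) :
  (forall x, x \in s -> f x \in multiples) -> \sum_(x <- s) f x \in multiples.
Proof.
move=> h; rewrite big_seq; elim/big_ind: _ => //; [exact: multiples0 | exact: multiplesD].
Qed.

Lemma multiplesP a : reflect (exists b, a = b *+ p) (a \in multiples).
Proof.
apply: (iffP idP) => [h|[b ->]].
  exists (inZp (a %/ p)); apply: val_inj; rewrite -FinRing.zmodXgE Zp_expg /=.
  by rewrite modnMml divnK // modn_small.
by rewrite -FinRing.zmodXgE Zp_expg inE /= dvdn_modulus dvdn_mull.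
Qed.

End Residues.

Section Reduction.
Variables (m q : nat).
Hypotheses (q_pr : prime q) (qm : (q %| m.+1)%N).
Implicit Types (a b : 'I_m.+1).

Definition red a : 'F_q := (a : nat)%:R.

Lemma Fp_mod k : (k %% m.+1)%:R = k%:R :> 'F_q.
Proof.
rewrite [in RHS](divn_eq k m.+1) natrD natrM.
have /eqP-> : m.+1%:R == 0 :> 'F_q by rewrite -(dvdn_pcharf (pchar_Fp q_pr)).
by rewrite mulr0 add0r.
Qed.

Lemma redD : {morph red : a b / a + b}.
Proof. by move=> a b; rewrite /red /= Fp_mod natrD. Qed.

Lemma red0 : red 0 = 0. Proof. by []. Qed.

Lemma redN : {morph red : a / - a}.
Proof. by move=> a; apply/eqP; rewrite -addr_eq0 -redD addNr red0. Qed.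

Lemma red_inZp k : red (inZp k) = k%:R.
Proof. exact: Fp_mod. Qed.

Lemma red_eq0 a : (red a == 0) = (q %| a)%N.
Proof. by rewrite (dvdn_pcharf (pchar_Fp q_pr)). Qed.

Lemma red_sum (T : Type) (r : seq T) (P : pred T) (f : T -> 'I_m.+1) :
  red (\sum_(x <- r | P x) f x) = \sum_(x <- r | P x) red (f x).
Proof. exact: (big_morph _ redD red0). Qed.

End Reduction.

(** A proper subgroup of a cyclic group consists of multiples of some prime dividing
    the order. *)
Lemma Zp_group_full m (H : {group 'I_m.+1}) :
  (forall q, prime q -> (q %| m.+1)%N -> exists2 h, h \in H & ~~ (q %| h)%N) ->
  H = [set: 'I_m.+1] :> {set _}.
Proof.
move=> h; apply/eqP; rewrite eqEcard finset.subsetT /= cardsT card_ord.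
have := cardSg (finset.subsetT H); rewrite cardsT card_ord => /dvdnP[k mE].
have [k1|k1] := leqP k 1.
  by rewrite (leq_trans (eq_leq mE)) // -[leqRHS]mul1n leq_mul2r k1 orbT.
have kq : (pdiv k %| m.+1)%N by rewrite mE dvdn_mulr // pdiv_dvd.
have [a aH /negP[]] := h _ (pdiv_prime k1) kq.
apply: dvdn_trans (pdiv_dvd k) _.
rewrite -(@dvdn_pmul2r #|H|) ?cardG_gt0 // -mE.
have := order_dvdG aH; rewrite order_dvdn Zp_expg => /eqP/(congr1 val) h0.
by apply/eqP.
Qed.

Section Cycles.
Variables (n : nat).
Implicit Types (u : 'S_n) (T : {set {set 'I_n}}).

Lemma trivIset_porbits u : finset.trivIset (porbits u).
Proof.
apply/finset.trivIsetP => c c' /imsetP[i _ ->] /imsetP[j _ ->].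
apply: contraR; rewrite -finset.setI_eq0 => /set0Pn[k]; rewrite inE => /andP[].
by rewrite -!eq_porbit_mem => /eqP<- /eqP->.
Qed.

Lemma sum_cover_cycles (V : zmodType) u T (f : 'I_n -> V) : T \subset porbits u ->
  \sum_(c in T) \sum_(j in c) f j = \sum_(j in finset.cover T) f j.
Proof.
by move=> sT; rewrite big_trivIset //; apply: trivIsetS sT (trivIset_porbits u).
Qed.

Lemma stable_cover u T : T \subset porbits u -> stable (finset.cover T) u.
Proof.
move=> /fintype.subsetP sT; apply/stableP => j.
apply/bigcupP/bigcupP => -[c cT]; have /stable_porbit/stableP h := sT c cT.
  by rewrite h => jc; exists c.
by move=> jc; exists c; rewrite ?h.
Qed.

Lemma cover_neq0 u T : T \subset porbits u -> T != finset.set0 ->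
  finset.cover T != finset.set0.
Proof.
move=> /fintype.subsetP sT /set0Pn[c cT]; apply/set0Pn.
have /imsetP[i _ ci] := sT _ cT; exists i; apply/bigcupP; exists c => //.
by rewrite ci porbit_id.
Qed.

Lemma cover_neqT u T : T \proper porbits u -> ~: finset.cover T != finset.set0.
Proof.
case/properP => sT [c cP cT]; apply/set0Pn.
have /imsetP[i _ ci] := cP; exists i; rewrite inE; apply/negP => /bigcupP[c' c'T].
have /imsetP[j _ cj] := fintype.subsetP sT _ c'T.
by rewrite cj -eq_porbit_mem -ci -cj => /eqP E; rewrite E c'T in cT.
Qed.

Lemma cover_sub_porbits u (S : {set 'I_n}) : stable S u ->
  finset.cover [set c in porbits u | c \subset S] = S.
Proof.
move=> sS; apply/setP => j; apply/bigcupP/idP => [[c]|jS].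
  by rewrite inE => /andP[_ /fintype.subsetP h] /h.
exists (porbit u j); last exact: porbit_id.
by rewrite inE imset_f //=; apply: stable_sub_porbit.
Qed.

End Cycles.

(** * The criterion in the wreath product *)

Section Criterion.
Variables (m p n : nat).
Hypotheses (n_gt0 : (0 < n)%N) (pm : (p %| m.+1)%N).
Local Notation A := 'I_m.+1.
Local Notation mult := (@multiples m p).
Implicit Types (es : seq ('I_n * 'I_n * A)) (e : 'I_n * 'I_n * A) (x y : wreath A n).
Implicit Types (S : {set 'I_n}) (i j : 'I_n).

Definition total x : A := wt [set: 'I_n] x.

Lemma stable_setT (u : 'S_n) : stable [set: 'I_n] u.
Proof. by apply/stableP => j; rewrite !inE. Qed.

Lemma totalM x y : total (x * y)%g = total x + total y.
Proof. by rewrite /total wtM ?stable_setT. Qed.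

Lemma total_refl e : total (refl e) = if e.1.1 == e.1.2 then e.2 else 0.
Proof. by case: e => -[i j] a; rewrite /total wt_refl !inE subrr. Qed.

Lemma all_stable S es :
  all (fun e => stable S (refl e).1) es = all (fun e => (e.1.1 \in S) == (e.1.2 \in S)) es.
Proof.
apply: eq_all => -[[i j] a] /=; apply/stableP/eqP => [/(_ j)|h k].
  by rewrite tpermR.
by case: tpermP => [->|->|].
Qed.

Lemma wt_wprod S es : all (fun e => (e.1.1 \in S) == (e.1.2 \in S)) es ->
  wt S (wprod es) = \sum_(e <- es) wt S (refl e).
Proof.
rewrite -all_stable => h; have := @wt_prod _ _ S [seq refl e | e <- es].
by rewrite all_map !big_map; apply.
Qed.

Lemma stable_wprod S es : all (fun e => (e.1.1 \in S) == (e.1.2 \in S)) es ->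
  stable S (wprod es).1.
Proof.
rewrite -all_stable => h; have := @stable_prod _ _ S [seq refl e | e <- es].
by rewrite all_map big_map; apply.
Qed.

Definition Gp : {set wreath A n} := [set x | total x \in mult].

Lemma Gp_group : group_set Gp.
Proof.
apply/group_setP; split=> [|x y]; first by rewrite inE /total wt1 multiples0.
by rewrite !inE totalM => hx hy; exact: multiplesD.
Qed.
Canonical Gp_Group := Group Gp_group.

Lemma refl_Gp e : is_refl_code mult e -> refl e \in Gp.
Proof.
rewrite /is_refl_code [refl e \in _]inE total_refl; case: eqP => [_ /andP[]//|_ _].
exact: multiples0.
Qed.

Definition gen_refl es := <<[set refl e | e in es]>>%g.

Lemma mem_gen_refl es e : e \in es -> refl e \in gen_refl es.
Proof. by move=> h; rewrite mem_gen // imset_f. Qed.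

Lemma gen_refl_sub es (H : {group wreath A n}) :
  (forall e, e \in es -> refl e \in H) -> gen_refl es \subset H.
Proof.
by move=> h; rewrite gen_subG; apply/fintype.subsetP => _ /imsetP[e /h eH ->].
Qed.

Definition no_proper_multiple x := forall T : {set {set 'I_n}},
  T != finset.set0 -> T \proper porbits x.1 ->
  \sum_(c in T) wt c x \notin mult.

(** A union [S] of components is preserved by all factors, so its weight is the sum
    of the labels of the diagonal factors in [S], a multiple of [p]; it is also the
    weight of the set of cycles inside [S]. *)
Lemma no_proper_multiple_connected es : all (is_refl_code mult) es ->
  no_proper_multiple (wprod es) -> connected es.
Proof.
move=> /allP ges nb S Sst; have st := stable_wprod Sst.
set x := wprod es in st.
(* The cycles inside S cover S, because S is preserved by the product. *)
pose T := [set c in porbits x.1 | c \subset S].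
have TS : finset.cover T = S := cover_sub_porbits st.
have sT : T \subset porbits x.1.
  by apply/fintype.subsetP => c; rewrite inE => /andP[].
have [S0|S0] := eqVneq S finset.set0; [by left | right].
have [//|ST] := eqVneq S [set: 'I_n].
have T0 : T != finset.set0.
  by apply: contraNneq S0 => T0; rewrite -TS T0 /finset.cover big_set0.
have TP : T \proper porbits x.1.
  rewrite finset.properEneq sT andbT; apply: contraNneq ST => T1; apply/eqP/setP => i.
  rewrite -TS T1 inE; apply/bigcupP; exists (porbit x.1 i); last exact: porbit_id.
  exact: imset_f.
case/negP: (nb T T0 TP).
rewrite (sum_cover_cycles x.2 sT) TS -/(wt S x) wt_wprod //.
apply: multiples_sum => // -[[i j] a] ees; have /ges := ees; rewrite /is_refl_code /=.
have /allP/(_ _ ees) /= /eqP h := Sst; rewrite wt_refl h.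
case: eqP => [_ /andP[_ aM]|_ _]; last by rewrite subrr multiples0.
by case: ifP => _; rewrite ?multiples0.
Qed.

Lemma total_Gp x : (<[total x]>%g = [set a *+ p | a : A]) ->
  forall y, y \in Gp -> total y \in <[total x]>%g.
Proof.
move=> -> y; rewrite inE => /multiplesP -/(_ pm)[b ->].
by apply/imsetP; exists b.
Qed.

(** The last condition makes the factorization connected, and the first two feed
    [connected_generates]. *)
Lemma refl_generate_Gp es :
  all (is_refl_code mult) es -> let x := wprod es in
  <<[set wt c x | c in porbits x.1]>>%g = [set: A] ->
  <[total x]>%g = [set a *+ p | a : A] ->
  no_proper_multiple x ->
  gen_refl es = Gp.
Proof.
move=> ges x h1 h2 h3; apply/eqP; rewrite finset.eqEsubset; apply/andP; split.
  by apply: (@gen_refl_sub _ Gp_Group) => e /(allP ges) /refl_Gp.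
apply/fintype.subsetP => y /(total_Gp h2).
apply: (connected_generates (H := <<_>>%G) (Ordinal n_gt0) _ _ h1).
  exact: no_proper_multiple_connected.
exact: mem_gen_refl.
Qed.

Definition edges es := [seq e <- es | e.1.1 != e.1.2].
Definition diagonals es := [seq e <- es | e.1.1 == e.1.2].

Lemma size_edges_diagonals es : (size (edges es) + size (diagonals es) = size es)%N.
Proof.
rewrite !size_filter addnC -(count_predC (fun e => e.1.1 == e.1.2)) //.
Qed.

Lemma total_wprod es : total (wprod es) = \sum_(e <- diagonals es) e.2.
Proof.
rewrite big_filter /total wt_wprod; last by apply/allP => e _; rewrite !inE.
by rewrite [RHS]big_mkcond /=; apply: eq_bigr => e _; rewrite -/(total _) total_refl.
Qed.

(** Diagonal factors are dropped, and the labels of the others are reduced by [f]. *)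
Definition map_edges (F : Type) (f : A -> F) es := [seq (e.1, f e.2) | e <- edges es].

Lemma perm_of_map_edges (F : fieldType) (f : A -> F) es :
  perm_of_edges (map_edges f es) = (wprod es).1.
Proof.
elim: es => [|e es ih]; first by rewrite /wprod big_nil.
rewrite /wprod big_cons perm_wreathM -/(wprod es) /= -ih /map_edges /=.
by case: eqP => //= ->; rewrite tperm1 mulg1.
Qed.

Lemma connected_map_edges (F : Type) (f : A -> F) es :
  connected es -> connected (map_edges f es).
Proof.
move=> conn S; rewrite all_map all_filter => h; apply: conn.
by apply: sub_all h => e /=; case: eqP => [->|].
Qed.

Lemma size_edges_ge es : connected es ->
  (n + #|porbits (wprod es).1| <= size (edges es) + 2)%N.
Proof.
move=> conn; have := @connected_map_edges _ (fun=> 0 : 'F_2) _ conn.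
by case/genus_zero_rigidity; rewrite perm_of_map_edges size_map.
Qed.

Section Rigidity.
Variable q : nat.
Hypotheses (q_pr : prime q) (qm : (q %| m.+1)%N).
Local Notation red := (@red m q).

(** Diagonal factors with zero residue act on the reduced labels as the identity, so
    dropping them does not change the reduced labels of the product. *)
Lemma label_map_edges es j : (forall e, e \in diagonals es -> red e.2 = 0) ->
  label_prod (map_edges red es) j = red ((wprod es).2 j).
Proof.
elim: es => [|e es ih] h; first by rewrite /wprod big_nil lab_wreath1 /label_prod big_ord0.
rewrite /wprod big_cons lab_wreathM redD // -/(wprod es) -ih; last first.
  move=> f; rewrite mem_filter => /andP[fs fes].
  by apply: h; rewrite mem_filter fs inE fes orbT.
rewrite -(perm_of_map_edges red) /map_edges /=.
have [ee|ne] /= := eqVneq e.1.1 e.1.2; last first.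
  rewrite label_prod_cons /=; congr (_ + _); rewrite ffunE.
  set k := perm_of_edges _ _.
  have [->|ki] := eqVneq k e.1.1; first by rewrite (negPf ne) subr0 mulr1.
  have [_|_] := eqVneq k e.1.2; first by rewrite sub0r mulrN1 redN.
  by rewrite subrr mulr0.
rewrite -[LHS]add0r; congr (_ + _); rewrite ffunE -ee.
by case: (_ == _); rewrite // h // mem_filter ee eqxx inE eqxx.
Qed.

Lemma rigid_potential es : connected es ->
  (size (edges es) + 2 <= n + #|porbits (wprod es).1|)%N ->
  (forall e, e \in diagonals es -> red e.2 = 0) ->
  (forall c, c \in porbits (wprod es).1 -> red (wt c (wprod es)) = 0) ->
  exists phi : 'I_n -> 'F_q, forall x, x \in gen_refl es ->
    forall j, red (x.2 j) = phi (x.1 j) - phi j.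
Proof.
move=> conn le sp0 c0.
have [_] := genus_zero_rigidity (@connected_map_edges _ red _ conn).
rewrite perm_of_map_edges size_map => /(_ le)[c /c0 cE|phi phiP].
  by rewrite -[RHS]cE /wt red_sum //; apply: eq_bigr => j _; exact: label_map_edges.
exists phi.
pose K := [set x : wreath A n | [forall j, red (x.2 j) == phi (x.1 j) - phi j]].
have KP x : reflect (forall j, red (x.2 j) = phi (x.1 j) - phi j) (x \in K).
  by rewrite inE; apply: (iffP forallP) => h j; apply/eqP; apply: h.
have gK : group_set K.
  apply/group_setP; split=> [|x y].
    by apply/KP => j; rewrite lab_wreath1 perm1 subrr.
  move=> /KP hx /KP hy; apply/KP => j.
  by rewrite lab_wreathM redD // hx hy perm_wreathM permM addrA subrK.
have sK : gen_refl es \subset Group gK.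
  apply: gen_refl_sub => e ees; apply/KP => j; rewrite ffunE /=.
  have [ee|ne] := eqVneq e.1.1 e.1.2.
    rewrite -ee tperm1 perm1 subrr.
    by case: (_ == _); rewrite // sp0 // mem_filter ee eqxx.
  have := phiP (e.1, red e.2); rewrite map_f ?mem_filter ?ne //= => /(_ isT) rE.
  case: tpermP => [->|->|/eqP/negPf-> /eqP/negPf->]; last by rewrite subrr.
    by rewrite eqxx.
  by rewrite eqxx eq_sym (negPf ne) redN // rE opprB.
by move=> x /(fintype.subsetP sK) /KP.
Qed.

End Rigidity.

(** The whole group permutes the points transitively. *)
Lemma gen_refl_connected es : gen_refl es = Gp -> connected es.
Proof.
move=> gE S; rewrite -all_stable => /allP Sst.
pose K := [set x : wreath A n | stable S x.1].
have gK : group_set K.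
  apply/group_setP; split=> [|x y]; first by rewrite inE stable1.
  by rewrite !inE perm_wreathM => hx hy; apply: stableM.
have /fintype.subsetP sK : gen_refl es \subset Group gK.
  by apply: gen_refl_sub => e ees; rewrite inE; apply: Sst.
have [->|/set0Pn[i iS]] := eqVneq S finset.set0; [by left | right].
apply/setP => j; rewrite !inE.
have : twist (fun=> 0) (tperm i j) \in gen_refl es.
  by rewrite gE inE /total wt_twist ?stable_setT // multiples0.
by move/sK; rewrite inE => /stableP/(_ i); rewrite tpermL => ->.
Qed.

(** For [n > 1], the group contains transpositions of the same two places with labels
    0 and 1, which have no common potential. For [n = 1] potentials only give zero
    labels, but [p = 1] provides the label 1. *)
Lemma Gp_not_potential q (phi : 'I_n -> 'F_q) : prime q -> (q %| m.+1)%N ->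
  (n = 1%N -> p = 1%N) ->
  ~ forall x, x \in Gp -> forall j, @red m q (x.2 j) = phi (x.1 j) - phi j.
Proof.
move=> q_pr qm n1 h; pose one : A := inZp 1.
have red1 : @red m q one = 1 by rewrite red_inZp.
have [n_gt1|n_le1] := ltnP 1 n.
  pose i := Ordinal n_gt0; pose j := Ordinal n_gt1.
  have ij : i != j by [].
  have rG a : refl (i, j, a) \in Gp.
    by rewrite inE total_refl; apply: multiples0.
  have := h _ (rG one) i; have := h _ (rG 0) i.
  rewrite /= !ffunE /= tpermL red0 red1 => <-.
  by apply/eqP; rewrite oner_eq0.
have n1E : n = 1%N by apply/eqP; rewrite eqn_leq n_le1.
pose i := Ordinal n_gt0.
have /h/(_ i) : refl (i, i, one) \in Gp.
  by rewrite inE total_refl inE n1 ?dvd1n.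
rewrite /= tperm1 perm1 subrr ffunE /= red1.
by apply/eqP; rewrite oner_eq0.
Qed.

(** The upper bound [factor_whole] and the lower bound [size_edges_ge] leave room for at
    most one diagonal factor, whose label then is the weight of [x], and for no
    transposition beyond [n + c - 2]. The first fact gives the condition on the
    weight of [x]. If the cycle weights did not generate Z/m, they would vanish
    modulo a prime [q], and rigidity modulo [q] would give all elements of the group
    a common potential, against [Gp_not_potential]. If a set of cycles had weight
    divisible by [p], then [factor_split] would give a shorter factorization, except
    when both blocks need a diagonal reflection and [es] has none; but then [x] has
    weight 0, so [p] is 0 in Z/m and the blocks have weight 0 as well. *)
Lemma shortest_generating_conditions es (x := wprod es) : (n = 1%N -> p = 1%N) ->
  all (is_refl_code mult) es ->
  (forall es', all (is_refl_code mult) es' -> wprod es' = x -> (size es <= size es')%N) ->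
  gen_refl es = Gp ->
  [/\ <<[set wt c x | c in porbits x.1]>>%g = [set: A],
      <[total x]>%g = [set a *+ p | a : A] &
      no_proper_multiple x].
Proof.
move=> n1 ges min gE; have conn := gen_refl_connected gE.
have xG : x \in Gp.
  by rewrite -gE /x /wprod big_seq; apply: group_prod => e /mem_gen_refl.
have xM : total x \in mult by move: xG; rewrite inE.
have lower := size_edges_ge conn; rewrite -/x in lower.
have upper : (size es + 2 <= n + #|porbits x.1| + (total x != 0%R))%N.
  have [es' [g' s' x']] := factor_whole n_gt0 xM.
  by apply: leq_trans s'; rewrite leq_add2r min.
have sizeE := size_edges_diagonals es.
have few : (size (diagonals es) <= (total x != 0%R))%N.
  move: lower upper sizeE; move: (nat_of_bool _) #|porbits x.1| => b c.
  by clear; lia.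
have diagE e : e \in diagonals es -> e.2 = total x.
  rewrite total_wprod; case: (diagonals es) few => [|f [|f' s]] //=.
    by rewrite big_seq1 inE => _ /eqP->.
  by case: (_ != 0).
have cyc : <[total x]>%g = [set a *+ p | a : A].
  have sub : Gp \subset [set y | total y \in <[total x]>%g].
    have gK : group_set [set y : wreath A n | total y \in <[total x]>%g].
      apply/group_setP; split=> [|y z]; first by rewrite inE /total wt1 group1.
      by rewrite !inE totalM => hy hz; rewrite groupM.
    rewrite -gE; apply: (@gen_refl_sub _ (Group gK)) => e ees.
    rewrite inE total_refl; case: ifP => [ee|_]; last exact: group1.
    by rewrite diagE ?cycle_id // mem_filter ee.
  apply/setP => a; apply/idP/imsetP => [|[b _ ->]].
    case/cycleP => k ->; have /multiplesP -/(_ pm)[b ->] := xM.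
    exists (b *+ k) => //.
    by rewrite FinRing.zmodXgE -!mulrnA mulnC.
  have : refl (Ordinal n_gt0, Ordinal n_gt0, b *+ p) \in Gp.
    rewrite inE total_refl eqxx; apply/multiplesP => //; by exists b.
  by move/(fintype.subsetP sub); rewrite inE total_refl eqxx.
split=> //.
- apply: (Zp_group_full (H := <<_>>%G)) => q q_pr qm; apply: contrapT => hno.
  have c0 c : c \in porbits x.1 -> red q (wt c x) = 0.
    move=> cP; apply/eqP; rewrite red_eq0 //; apply/negPn/negP => h.
    by apply: hno; exists (wt c x) => //; rewrite mem_gen //; apply/imsetP; exists c.
  have t0 : red q (total x) = 0.
    have -> : total x = wt (finset.cover (porbits x.1)) x.
      congr (wt _ x); apply/setP => i; rewrite inE; symmetry; apply/bigcupP.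
      by exists (porbit x.1 i); [exact: imset_f | exact: porbit_id].
    rewrite /wt -(sum_cover_cycles x.2 (fintype.subxx _)).
    by rewrite red_sum // big1.
  have [||//|phi phiP] := @rigid_potential q q_pr qm es conn.
  + rewrite -/x; case: (eqVneq (total x) 0) few upper => [_|x0] few upper.
      by move: sizeE upper; clear; lia.
    suff : (0 < size (diagonals es))%N by move: sizeE upper; clear; lia.
    rewrite lt0n size_eq0; apply: contraNneq x0 => s0.
    by rewrite /x total_wprod s0 big_nil.
  + by move=> e /diagE ->.
  by rewrite gE in phiP; exact: (Gp_not_potential q_pr qm n1 phiP).
move=> T T0 Tp; apply/negP.
have sT := proper_sub Tp; have sS := stable_cover sT.
rewrite (sum_cover_cycles x.2 sT) -/(wt _ x); set S := finset.cover T in sS * => SM.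
have tE : total x = wt S x + wt (~: S) x.
  rewrite /total /wt (bigID (mem S)) /=; congr (_ + _).
    by apply: eq_bigl => i; rewrite inE.
  by apply: eq_bigl => i; rewrite !inE.
have SCM : wt (~: S) x \in mult.
  have -> : wt (~: S) x = total x + - wt S x by rewrite tE addrC addKr.
  by apply: multiplesD => //; apply: multiplesN.
have [es' [g' s' x']] := factor_split sS (cover_neq0 sT T0) (cover_neqT Tp) SM SCM.
have few' : (size (diagonals es) + 2 <= (wt S x != 0%R) + (wt (~: S) x != 0%R))%N.
  have := leq_trans (leq_add (min _ g' x') (leqnn 4)) s'.
  move: lower sizeE; move: (nat_of_bool _) (nat_of_bool _) #|_| => b b' c.
  by clear; lia.
have [w1 s0] : (wt S x != 0) /\ size (diagonals es) = 0%N.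
  by move: few'; case: (wt S x != 0); case: (_ != 0); case: (size _) => // k;
     rewrite ?addnS ?addSn.
move: w1; have /multiplesP -/(_ pm)[b ->] := SM => /eqP[].
have : b *+ p \in <[total x]>%g by rewrite cyc; apply/imsetP; exists b.
have -> : total x = 0 by rewrite /x total_wprod (size0nil s0) big_nil.
by rewrite cycle1 => /set1P.
Qed.

End Criterion.

(** * Passing to monomial matrices *)

Section Matrices.
Variables (R : realType) (m n : nat).
Local Notation A := 'I_m.+1.
Implicit Types (x y : wreath A n) (a b : A) (e : 'I_n * 'I_n * A).

Definition zeta a : R[i] := omega R m.+1 ^+ a.

Lemma zetaD a b : zeta (a + b) = zeta a * zeta b.
Proof. by rewrite /zeta /= (prim_expr_mod (omega_prim R (ltn0Sn m))) exprD. Qed.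

Lemma zeta0 : zeta 0 = 1. Proof. by []. Qed.

Lemma zetaN a : zeta a * zeta (- a) = 1.
Proof. by rewrite -zetaD subrr. Qed.

Lemma zeta_neq0 a : zeta a != 0.
Proof.
by apply/eqP => h; have /eqP := zetaN a; rewrite h mul0r eq_sym oner_eq0.
Qed.

Lemma zeta_inj : injective zeta.
Proof.
move=> a b /eqP; rewrite /zeta (eq_prim_root_expr (omega_prim R (ltn0Sn m))).
by rewrite !modn_small // => /eqP/val_inj.
Qed.

Lemma zeta_eq1 a : (zeta a == 1) = (a == 0).
Proof. by rewrite -zeta0 (inj_eq zeta_inj). Qed.

Definition mxw x : 'M[R[i]]_n :=
  \matrix_(i, j) (if i == x.1 j then zeta (x.2 j) else 0).

Lemma mxwE x : mx_perm (mxw x) = x.1 /\ mx_exp m.+1 (mxw x) =1 x.2.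
Proof. exact: (@mx_perm_expE R m.+1 n x.1 x.2). Qed.

Lemma mxw_inj : injective mxw.
Proof.
move=> x y xy; have [h1 h2] := mxwE x; have [h3 h4] := mxwE y.
by apply: wreathP => [|j]; rewrite -?h1 -?h2 xy.
Qed.

Lemma mxw1 : mxw 1%g = 1%:M.
Proof.
apply/matrixP => i j; rewrite !mxE perm1 lab_wreath1 zeta0.
by case: (i == j).
Qed.

Lemma mxwM x y : mxw (x * y)%g = mxw x *m mxw y.
Proof.
apply/matrixP => i j; rewrite !mxE (bigD1 (y.1 j)) //= !mxE eqxx big1 ?addr0.
  rewrite permM lab_wreathM zetaD; case: ifP => _ //; by rewrite mul0r.
by move=> k /negPf kj; rewrite !mxE kj mulr0.
Qed.

Lemma mxwV x : mxw x \in unitmx /\ invmx (mxw x) = mxw x^-1%g.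
Proof.
have h : mxw x *m mxw x^-1%g = 1%:M by rewrite -mxwM mulgV mxw1.
have [u _] := mulmx1_unit h; split=> //.
by rewrite -[RHS](mulKmx u) h mulmx1.
Qed.

Lemma mxw_neq0 x i j : (mxw x i j != 0) = (i == x.1 j).
Proof. by rewrite mxE; case: ifP; rewrite ?zeta_neq0 ?eqxx. Qed.

Lemma mxw_wprod (es : seq ('I_n * 'I_n * A)) :
  mxw (wprod es) = \prod_(t <- [seq mxw (refl e) | e <- es]) t.
Proof.
rewrite big_map /wprod; elim: es => [|e es ih]; first by rewrite !big_nil mxw1.
by rewrite !big_cons mxwM ih.
Qed.

Lemma mxw_prod x :
  \prod_(ij : 'I_n * 'I_n | mxw x ij.1 ij.2 != 0) mxw x ij.1 ij.2 = zeta (total x).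
Proof.
rewrite big_mkcond -(pair_bigA _ (fun i j => if mxw x i j != 0 then mxw x i j else 1)) /=.
rewrite exchange_big /= /total /wt (big_morph zeta zetaD zeta0).
rewrite [RHS]big_mkcond /=; apply: eq_bigr => j _; rewrite finset.in_setT.
rewrite (bigD1 (x.1 j)) //= big1 => [|i ij].
  by rewrite mxw_neq0 eqxx mxE eqxx mulr1.
by rewrite mxw_neq0 (negPf ij).
Qed.

Lemma mxw_Gmpn p x : (0 < p)%N -> (p %| m.+1)%N ->
  Gmpn m.+1 p (mxw x) <-> x \in @Gp m p n.
Proof.
move=> p0 pm; have -> : (x \in @Gp m p n) = (zeta (total x) ^+ (m.+1 %/ p) == 1).
  rewrite /zeta -exprM -(prim_order_dvd (omega_prim R (ltn0Sn m))) inE.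
  rewrite -[X in (X %| _)%N](divnK pm) mulnC dvdn_pmul2r //.
  by rewrite divn_gt0 // dvdn_leq.
rewrite /Gmpn /= mxw_prod; split=> [[_ _ ->]//|/eqP h]; split=> //.
  split=> [i|j].
    exists (x.1^-1 i)%g; split=> [|j]; rewrite mxw_neq0 ?permKV // => /eqP->.
    by rewrite permK.
  by exists (x.1 j); split=> [|i]; rewrite mxw_neq0 // => /eqP->.
move=> i j; rewrite mxw_neq0 mxE => ->.
by rewrite /zeta exprAC (prim_expr_order (omega_prim R _)) ?expr1n.
Qed.

Lemma Gmpn_mxw p (g : 'M[R[i]]_n) : Gmpn m.+1 p g -> exists x, g = mxw x.
Proof.
move=> h; rewrite (GmpnE (ltn0Sn m) h).
exists (mx_perm g, [ffun j => mx_exp m.+1 g j]).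
by apply/matrixP => i j; rewrite !mxE ffunE.
Qed.

(** Matrices of rank 1 are products of a column and a row. *)
Lemma rank1_minor (F : fieldType) (k l : nat) (B : 'M[F]_(k, l)) : \rank B = 1%N ->
  forall i j i' j', B i j * B i' j' = B i j' * B i' j.
Proof.
move: (col_base B) (row_base B) (mulmx_base B) => C D CD r1.
move: C D CD; rewrite r1 => C D <- i j i' j'.
by rewrite !mxE !big_ord1 mulrACA (mulrC (D _ _)) mulrACA.
Qed.

Lemma rank1_mul (F : fieldType) (k l : nat) (c : 'cV[F]_k) (r : 'rV[F]_l) :
  c *m r != 0 -> \rank (c *m r) = 1%N.
Proof.
rewrite -mxrank_eq0 => h; apply/eqP; rewrite eqn_leq lt0n h andbT.
exact: leq_trans (mxrankM_maxl _ _) (rank_leq_col _).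
Qed.

(** The fixed space of [t] is the kernel of [t - 1]. *)
Lemma is_reflection_rank1 (t : 'M[R[i]]_n) : (0 < n)%N ->
  is_reflection t <-> \rank (t - 1%:M) = 1%N.
Proof.
move=> n0; rewrite /is_reflection /eigenspace mxrank_ker.
have -> : t^T - 1%:M = (t - 1%:M)^T by rewrite linearB /= trmx1.
rewrite mxrank_tr; have := rank_leq_row (t - 1%:M).
move: (\rank _) => r rn; split; lia.
Qed.

Lemma mxw_sub1 x i j :
  (mxw x - 1%:M) i j = (if i == x.1 j then zeta (x.2 j) else 0) - (i == j)%:R.
Proof. by rewrite !mxE. Qed.

Lemma reflection_mxw_refl i j a : (0 < n)%N -> (i != j) || (a != 0) ->
  is_reflection (mxw (refl (i, j, a))).
Proof.
move=> n0 h; apply/is_reflection_rank1 => //.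
have [ij|ij] := eqVneq i j.
  rewrite ij eqxx /= in h *.
  have E : mxw (refl (j, j, a)) - 1%:M = ((zeta a - 1) *: delta_mx j 0) *m delta_mx (0 : 'I_1) j.
    rewrite -scalemxAl mul_delta_mx; apply/matrixP => k l.
    rewrite mxw_sub1 /= tperm1 perm1 !mxE ffunE /=.
    have [->|kl] := eqVneq k l.
      have [_|lj] := eqVneq l j; first by rewrite mulr1.
      by rewrite zeta0 subrr mulr0.
    have [kj|kj] := eqVneq k j; last by rewrite mulr0 subrr.
    by rewrite -kj eq_sym (negPf kl) mulr0 subrr.
  rewrite E rank1_mul // -E; apply/eqP => /matrixP/(_ j j)/eqP.
  by rewrite mxw_sub1 /= tperm1 perm1 eqxx ffunE /= eqxx mxE subr_eq0 zeta_eq1 (negPf h).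
have E : mxw (refl (i, j, a)) - 1%:M =
   (zeta a *: delta_mx j 0 - delta_mx i 0) *m
   (delta_mx (0 : 'I_1) i - zeta (- a) *: delta_mx 0 j).
  apply/matrixP => k l; rewrite mxw_sub1 !mxE big_ord1 !mxE eqxx /= ffunE /=.
  have ji : (j == i) = false by rewrite eq_sym (negPf ij).
  have [->|li] := eqVneq l i.
    rewrite tpermL (negPf ij) ?andbT mulr0 subr0 mulr1.
    have [->|kj] := eqVneq k j; first by rewrite ji mulr1.
    by rewrite mulr0.
  have [->|lj] := eqVneq l j.
    rewrite tpermR mulr1 sub0r mulrN mulrBl -mulrA (mulrC _ (zeta _)) mulrA.
    have [->|ki] := eqVneq k i; first by rewrite (negPf ij) !mulr0 !subr0 sub0r mul1r opprK.
    by rewrite zetaN mul1r mul0r subr0 andbT sub0r.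
  rewrite tpermD; [|by rewrite eq_sym..]; rewrite zeta0 mulr0 subrr mulr0.
  by case: (k == l); rewrite subrr.
rewrite E rank1_mul // -E; apply/eqP => /matrixP/(_ i i)/eqP.
by rewrite mxw_sub1 /= tpermL (negPf ij) eqxx mxE sub0r oppr_eq0 oner_eq0.
Qed.

(** The 2 x 2 minors of [C = x - 1] vanish. If [x] moves [i] to [k], then comparing
    with column [i], which is supported on [i] and [k], shows that [k] is moved
    back to [i] with the inverse entry and that all other columns of [C] vanish. If
    [x] is diagonal, then so is [C], and only one diagonal entry can be nonzero. *)
Lemma mxw_reflection x : (0 < n)%N -> is_reflection (mxw x) ->
  exists e, x = refl e /\ (e.1.1 != e.1.2) || (e.2 != 0).
Proof.
move=> n0 /is_reflection_rank1 -/(_ n0) r1.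
have minor := rank1_minor r1.
have B := mxw_sub1 x; set C := mxw x - 1%:M in r1 minor B.
have [/forallP u1|] := boolP [forall i, x.1 i == i].
  have diag l : C l l = zeta (x.2 l) - 1 by rewrite B (eqP (u1 l)) eqxx.
  have off k l : k != l -> C k l = 0.
    by move=> kl; rewrite B (eqP (u1 l)) (negPf kl) subrr.
  have [[i xi]|none] : (exists i, x.2 i != 0) \/ (forall i, x.2 i = 0).
    have [/existsP|] := boolP [exists i, x.2 i != 0]; first by left.
    by rewrite negb_exists => /forallP h; right => i; apply/eqP/negPn.
  - exists (i, i, x.2 i); rewrite xi orbT; split=> //; apply: wreathP => [|l] /=.
      by apply/permP => l; rewrite tperm1 perm1; apply/eqP.
    rewrite ffunE /=; have [->//|li] := eqVneq l i.
    have il : i != l by rewrite eq_sym.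
    have /eqP := minor i i l l; rewrite (off i l) // mul0r !diag mulf_eq0.
    by rewrite !subr_eq0 !zeta_eq1 (negPf xi) => /eqP.
  have C0 : C = 0.
    apply/matrixP => k l; rewrite [RHS]mxE; have [->|/off//] := eqVneq k l.
    by rewrite diag none zeta0 subrr.
  by rewrite C0 mxrank0 in r1.
rewrite negb_forall => /existsP[i ui]; set k := x.1 i in ui.
have Cii : C i i = -1 by rewrite B eq_sym (negPf ui) eqxx sub0r.
have uk : x.1 k = i.
  have kk : x.1 k != k by rewrite /k (inj_eq (@perm_inj _ _)).
  apply/eqP; apply: contraT => ki.
  have /eqP := minor i i (x.1 k) k; rewrite Cii (B _ i) (negPf ki) -/k (negPf kk).
  rewrite subrr mulr0 B eqxx (negPf kk) subr0 mulN1r oppr_eq0.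
  by rewrite (negPf (zeta_neq0 _)).
have fix_ l : l != i -> l != k -> x.1 l = l /\ x.2 l = 0.
  move=> li lk; have /eqP := minor i i l l.
  rewrite (B l i) -/k (negPf lk) (negPf li) subrr mulr0 Cii mulN1r oppr_eq0.
  rewrite B eqxx; case: (eqVneq l (x.1 l)) => [lE|_]; last by rewrite sub0r oppr_eq0 oner_eq0.
  by rewrite subr_eq0 zeta_eq1 => /eqP.
have ak : x.2 k = - x.2 i.
  apply/eqP; rewrite -addr_eq0 -zeta_eq1 zetaD; apply/eqP.
  have := minor i i k k; rewrite Cii !B uk -/k !eqxx (negPf ui) (eq_sym i k) (negPf ui).
  by rewrite !subr0 sub0r mulrNN mulr1.
exists (i, k, x.2 i); rewrite eq_sym ui; split=> //; apply: wreathP => [|l] /=.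
  apply/permP => l; case: tpermP => [->//|->//|/eqP li /eqP lk].
  by have [] := fix_ l li lk.
rewrite ffunE /=; have [->//|li] := eqVneq l i; have [->//|lk] := eqVneq l k.
by have [] := fix_ l li lk.
Qed.

End Matrices.

Section Transfer.
Variables (R : realType) (m p n : nat).
Hypotheses (n_gt0 : (0 < n)%N) (p_gt0 : (0 < p)%N) (pm : (p %| m.+1)%N).
Local Notation A := 'I_m.+1.
Local Notation mult := (@multiples m p).
Local Notation mxw := (@mxw R m n).
Implicit Types (es : seq ('I_n * 'I_n * A)) (x y : wreath A n).

Lemma mxw_reflectionP (t : 'M[R[i]]_n) :
  Gmpn m.+1 p t /\ is_reflection t <-> exists2 e, is_refl_code mult e & t = mxw (refl e).
Proof.
split=> [[tG]|[e eg ->]].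
  have [x tE] := Gmpn_mxw tG; rewrite tE in tG *.
  move=> /(mxw_reflection n_gt0)[e [xE eN]]; exists e; last by rewrite xE.
  move/(mxw_Gmpn _ _ p_gt0 pm): tG; rewrite inE xE total_refl /is_refl_code.
  by move: eN; case: eqP => //= _ ->.
split; first by apply/mxw_Gmpn => //; apply: refl_Gp.
case: e eg => -[i j] a eg; apply: reflection_mxw_refl => //.
by move: eg; rewrite /is_refl_code /=; case: (i != j) => //= /andP[].
Qed.

Lemma refl_factorizationP (f : seq 'M[R[i]]_n) x :
  refl_factorization m.+1 p f (mxw x) <->
  exists es, [/\ all (is_refl_code mult) es, f = [seq mxw (refl e) | e <- es] & wprod es = x].
Proof.
split=> [[fG fx]|[es [ges -> <-]]]; last first.
  split; last by rewrite mxw_wprod.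
  by move=> t /mapP[e /(allP ges) eg ->]; apply/mxw_reflectionP; exists e.
have [es ges fE] : exists2 es, all (is_refl_code mult) es & f = [seq mxw (refl e) | e <- es].
  elim: f fG {fx} => [|t f ih] fG; first by exists [::].
  have [|es ges ->] := ih; first by move=> s sf; apply: fG; rewrite inE sf orbT.
  have /mxw_reflectionP[e eg ->] := fG t (mem_head _ _).
  by exists (e :: es) => //=; rewrite eg.
exists es; split=> //; apply: (@mxw_inj R).
by rewrite mxw_wprod -fE.
Qed.

(** The image of the generated finite group is a matrix group; conversely, the
    elements of the wreath product whose matrix lies in a given matrix group are
    closed under products, hence form a subgroup by finiteness. *)
Lemma generated_mxw es :
  generated_subgroup [seq mxw (refl e) | e <- es] =
  [set mxw x | x in [set x | x \in gen_refl es]]%classic.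
Proof.
apply/seteqP; split.
  apply: smallest_sub => [|_ /mapP[e ees ->]]; last first.
    by exists (refl e) => //=; apply: mem_gen_refl.
  split.
  - by move=> _ [x _ <-]; have [] := mxwV R x.
  - by exists 1%g; rewrite ?mxw1 //= group1.
  - by move=> _ _ [x /= xH <-] [y /= yH <-]; exists (x * y)%g; rewrite ?mxwM //= groupM.
  - by move=> _ [x /= xH <-]; exists x^-1%g; rewrite /= ?groupV //; have [_ ->] := mxwV R x.
move=> _ [x /= xH <-] X [[Xu X1 XM XV] fX].
pose K := [set y | `[< X (mxw y) >]]%SET.
have KP y : reflect (X (mxw y)) (y \in K) by rewrite finset.inE; apply: asboolP.
have gK : group_set K.
  apply/group_setP; split=> [|y z]; first by apply/KP; rewrite mxw1.
  by move=> /KP hy /KP hz; apply/KP; rewrite mxwM; apply: XM.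
have /fintype.subsetP/(_ x xH)/KP // : gen_refl es \subset Group gK.
by apply: gen_refl_sub => e ees; apply/KP; apply: fX; apply: map_f.
Qed.

Lemma generated_Gmpn es :
  generated_subgroup [seq mxw (refl e) | e <- es] = @Gmpn R m.+1 p n <->
  gen_refl es = @Gp m p n.
Proof.
rewrite generated_mxw; split=> [h|->].
  apply/setP => x; apply/idP/idP => hx.
    by apply/(@mxw_Gmpn R) => //; rewrite -h; exists x.
  have : Gmpn m.+1 p (mxw x) by apply/mxw_Gmpn.
  by rewrite -h => -[y /= yH /mxw_inj <-].
apply/seteqP; split=> [_ [x /= xG <-]|g gG]; first exact/mxw_Gmpn.
have [x gE] := Gmpn_mxw gG; rewrite gE in gG *.
by exists x => //=; apply/(@mxw_Gmpn R).
Qed.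

Lemma shortest_generating_mxw x : (n = 1%N -> p = 1%N) -> x \in @Gp m p n ->
  (exists f : seq 'M[R[i]]_n,
      shortest_refl_factorization m.+1 p f (mxw x) /\
      generated_subgroup f = @Gmpn R m.+1 p n) <->
  [/\ <<[set wt c x | c in porbits x.1]>>%g = [set: A]%SET,
      <[total x]>%g = [set a *+ p | a : A]%SET &
      no_proper_multiple p x].
Proof.
move=> n1 xG; split.
  case=> f [[/refl_factorizationP[es [ges -> esx]] fmin] /generated_Gmpn gE].
  rewrite -esx; apply: shortest_generating_conditions => // es' ges' esx'.
  rewrite -(size_map (fun e => mxw (refl e)) es) -(size_map (fun e => mxw (refl e)) es').
  by apply: fmin; apply/refl_factorizationP; exists es'; rewrite esx' esx.
case=> h1 h2 h3.
have xM : total x \in mult by rewrite inE in xG.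
have exes : exists k, `[< exists es, [/\ all (is_refl_code mult) es, wprod es = x & size es = k] >].
  have [es [ges _ esx]] := factor_whole n_gt0 xM.
  by exists (size es); apply/asboolP; exists es.
case: (ex_minnP exes) => k /asboolP[es [ges esx <-]] kmin.
exists [seq mxw (refl e) | e <- es]; split.
  split; first by apply/refl_factorizationP; exists es.
  move=> _ /refl_factorizationP[es' [ges' -> esx']]; rewrite !size_map.
  by apply: kmin; apply/asboolP; exists es'.
by apply/generated_Gmpn; apply: refl_generate_Gp => //; rewrite esx.
Qed.

End Transfer.

Theorem lemma5p3 (R : realType) (m p n : nat)
    (m_gt0 : (0 < m)%N) (p_gt0 : (0 < p)%N) (n_gt0 : (0 < n)%N)
    (p_dvd_m : (p %| m)%N) (n1_p1 : n = 1%N -> p = 1%N) (g : 'M[R[i]]_n) (gG : Gmpn m p g) :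
  (exists f : seq 'M[R[i]]_n,
      shortest_refl_factorization m p f g /\
      generated_subgroup f = @Gmpn R m p n)
  <->
  [/\ <<[set cycle_weight m g c | c in cycles g]>>%g = [set: Zmod m]%SET,
      <[weight m g]>%g = [set x *+ p | x : Zmod m]%SET &
      forall S : {set {set 'I_n}},
        S != finset.set0 -> S \proper cycles g ->
        ~~ (p %| cycles_weight m g S)%N].
Proof.
case: m m_gt0 p_dvd_m gG => // m _ pm gG.
have [x gE] := Gmpn_mxw gG; rewrite gE in gG *.
have /(mxw_Gmpn _ _ p_gt0 pm) xG := gG.
have [uE aE] := mxwE R x.
have wE c : cycle_weight m.+1 (mxw R x) c = wt c x.
  by apply: eq_bigr => j _; rewrite aE.
have tE : weight m.+1 (mxw R x) = total x.
  by rewrite /weight /total /wt; apply: eq_big => j; rewrite ?finset.in_setT ?aE.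
have sE S : cycles_weight m.+1 (mxw R x) S = \sum_(c in S) wt c x.
  by apply: eq_bigr => c _; apply: wE.
rewrite (shortest_generating_mxw R n_gt0 p_gt0 pm n1_p1 xG) tE /cycles uE.
rewrite (finset.eq_imset _ wE); split=> -[h1 h2 h3]; split=> // S S0 Sp.
  by rewrite sE; apply: h3.
by have := h3 S S0 Sp; rewrite sE.
Qed.
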